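(* Assume that the left boundary kernel $K^L(\cdot;\alpha)$, $\alpha\in\,]0,1[$, satisfies $$\alpha\,(1-\mu_{0,L}(\alpha))+\mu_{1,L}(\alpha)=0\quad\text{for all }\alpha\in\,]0,1[,$$ and $$\int_0^1|\mu_{0,L}|(\alpha)^2\,d\alpha<\infty,$$ and that the restriction of $F$ to the interval $[a,b]$ is twice continuously differentiable. Then, as $n\to\infty$ (with $h=h_n\to0$), $$\mathbf{V}(F;h)=\frac1n\int F(x)(1-F(x))\,dx-\frac hn\int uB(u)\,du+O\big(n^{-1}h^2\big)$$ and $$\mathbf{B}(F;h)=\frac{h^4}{4}\left(\int u^2K(u)\,du\right)^2\int F''(x)^2\,dx+o\big(h^4\big).$$ Moreover, if $F$ is not the uniform distribution function on $[a,b]$, the asymptotically optimal bandwidth, in the sense of minimising over $h>0$ the leading terms of the expansion of $\mathrm{MISE}(F;h)=\mathbf{V}(F;h)+\mathbf{B}(F;h)$, namely $$\frac1n\int F(x)(1-F(x))\,dx-\frac hn\int uB(u)\,du+\frac{h^4}{4}\left(\int u^2K(u)\,du\right)^2\int F''(x)^2\,dx,$$ is given by $$h_0=\delta(K)\left(\int F''(x)^2\,dx\right)^{-1/3}n^{-1/3},\qquad \delta(K)=\left(\int uB(u)\,du\right)^{1/3}\left(\int u^2K(u)\,du\right)^{-2/3}.$$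
   Context: $X_1,\dots,X_n$ are independent copies of an absolutely continuous real random variable with density $f$ and distribution function $F$, where the support of $f$ is the finite interval $[a,b]$. Integrals without limits are over the whole real line ($F''$ vanishes outside $[a,b]$, so $\int F''(x)^2dx=\int_a^bF''(x)^2dx$). $K$ is a kernel on $\mathbb{R}$, i.e. a bounded and symmetric probability density function with support $[-1,1]$, $\bar K(u)=\int_{-\infty}^u K(v)\,dv$, and $B(u)=2\bar K(u)K(u)$. The bandwidth $h=h_n$ is a sequence of strictly positive real numbers converging to zero as $n\to\infty$, with $0<h\le (b-a)/2$. Left boundary kernel: for each $\alpha\in\,]0,1[$, $K^L(\cdot;\alpha)$ is a real function on $\mathbb{R}$ with support contained in $[-1,\alpha]$ and $|\mu_{0,L}|(\alpha):=\int|K^L(u;\alpha)|\,du<\infty$. For $k\in\{0,1,2,\dots\}$, $\mu_{k,L}(\alpha)=\int u^kK^L(u;\alpha)\,du$. The right boundary kernel is $K^R(u;\alpha)=K^L(-u;\alpha)$. Put $$\bar K^L(u;\alpha)=\int_{-\infty}^uK^L(v;\alpha)\,dv,\qquad \bar K^R(u;\alpha)=1-\int_u^{+\infty}K^R(v;\alpha)\,dv.$$ The boundary modified kernel distribution function estimator is $\tilde F_{nh}(x)=0$ for $x\le a$, $\tilde F_{nh}(x)=1$ for $x\ge b$, and for $a<x<b$, $$\tilde F_{nh}(x)=\frac1n\sum_{i=1}^n\bar K_{x,h}\Big(\frac{x-X_i}{h}\Big),$$ where $\bar K_{x,h}(u)=\bar K^L(u;(x-a)/h)$ if $a<x<a+h$,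 $\bar K_{x,h}(u)=\bar K(u)$ if $a+h\le x\le b-h$, and $\bar K_{x,h}(u)=\bar K^R(u;(b-x)/h)$ if $b-h<x<b$. The mean integrated squared error is $$\mathrm{MISE}(F;h)=\mathrm{E}\int\{\tilde F_{nh}(x)-F(x)\}^2dx=\mathbf{V}(F;h)+\mathbf{B}(F;h),$$ with $\mathbf{V}(F;h)=\int\mathrm{Var}\,\tilde F_{nh}(x)\,dx$ and $\mathbf{B}(F;h)=\int\{\mathrm{E}\tilde F_{nh}(x)-F(x)\}^2dx$. *)

(* Defs.v *)
From HB Require Import structures.
From mathcomp Require Import all_boot all_order all_algebra.
From mathcomp Require Import all_classical all_reals all_analysis.

Set Implicit Arguments.
Unset Strict Implicit.
Unset Printing Implicit Defensive.

Import Order.TTheory GRing.Theory Num.Theory.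
Import numFieldNormedType.Exports.

Local Open Scope classical_set_scope.
Local Open Scope ring_scope.

Definition tsupport (R : realType) (g : R -> R) : set R :=
  closure [set x | g x != 0].

(* Derivative relative to A; one-sided at the end points when A is a compact
   interval. *)
Definition is_derive_in (R : realType) (A : set R) (g : R -> R) (x l : R) :
    Prop :=
  (fun y : R => (g y - g x) / (y - x)) @ within A x^' --> l.

Definition C2_on (R : realType) (A : set R) (g : R -> R) : Prop :=
  exists g1 g2 : R -> R,
    [/\ forall x, A x -> is_derive_in A g x (g1 x),
        forall x, A x -> is_derive_in A g1 x (g2 x) &
        {within A, continuous g2}].

Definition mutually_independent (d : measure_display) (T : measurableType d)
    (R : realType) (P : probability T R) (X : nat -> {RV P >-> R}) : Prop :=
  forall (s : seq nat) (A : nat -> set R), uniq s ->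
    (forall i, i \in s -> measurable (A i)) ->
    P (\bigcap_(i in [set` s]) (X i @^-1` A i)) =
    (\prod_(i <- s) P (X i @^-1` A i))%E.

Definition is_density (d : measure_display) (T : measurableType d)
    (R : realType) (P : probability T R) (Y : {RV P >-> R}) (f : R -> R) :
    Prop :=
  [/\ measurable_fun [set: R] f, forall x, 0 <= f x &
      forall A : set R, measurable A ->
        distribution P Y A = (\int[lebesgue_measure]_(x in A) (f x)%:E)%E].

Record is_kernel (R : realType) (K : R -> R) : Prop := IsKernel {
  kernel_measurable : measurable_fun [set: R] K;
  kernel_ge0 : forall u, 0 <= K u;
  kernel_integral1 : (\int[lebesgue_measure]_u (K u)%:E = 1)%E;
  kernel_bounded : exists M, forall u, K u <= M;
  kernel_symmetric : forall u, K (- u) = K u;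
  kernel_support : tsupport K = `[-1, 1]%classic }.

Definition Kbar (R : realType) (K : R -> R) (u : R) : R :=
  \int[lebesgue_measure]_(v in `]-oo, u]) K v.

Definition Bfun (R : realType) (K : R -> R) (u : R) : R :=
  2 * Kbar K u * K u.

(* A boundary kernel is a function KL of (u, alpha); its values matter only for
   alpha in ]0, 1[. *)
Definition is_boundary_kernel (R : realType) (KL : R -> R -> R) : Prop :=
  forall al, 0 < al < 1 ->
    tsupport (KL^~ al) `<=` `[-1, al] /\
    (@lebesgue_measure R).-integrable [set: R]
      (fun u => (KL u al)%:E).

Definition jointly_measurable (R : realType) (KL : R -> R -> R) : Prop :=
  measurable_fun ([set: R] `*` [set` `]0, 1[] :
      set (measurableTypeR R * measurableTypeR R)%type)
    (fun p => KL p.1 p.2).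

Definition absmu0 (R : realType) (KL : R -> R -> R) (al : R) : R :=
  \int[lebesgue_measure]_u `|KL u al|.

Definition muL (R : realType) (KL : R -> R -> R) (k : nat) (al : R) : R :=
  \int[lebesgue_measure]_u (u ^+ k * KL u al).

Definition KbarL (R : realType) (KL : R -> R -> R) (u al : R) : R :=
  \int[lebesgue_measure]_(v in `]-oo, u]) KL v al.

Definition KR (R : realType) (KL : R -> R -> R) (u al : R) : R := KL (- u) al.

Definition KbarR (R : realType) (KL : R -> R -> R) (u al : R) : R :=
  1 - \int[lebesgue_measure]_(v in `[u, +oo[) KR KL v al.

Definition Kbar_loc (R : realType) (K : R -> R) (KL : R -> R -> R)
    (a b h x u : R) : R :=
  if x < a + h then KbarL KL u ((x - a) / h)
  else if x <= b - h then Kbar K u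
  else KbarR KL u ((b - x) / h).

Definition estimator (R : realType) (K : R -> R) (KL : R -> R -> R) (a b : R)
    (T : Type) (X : nat -> T -> R) (n : nat) (h x : R) (w : T) : R :=
  if x <= a then 0
  else if b <= x then 1
  else n%:R^-1 * \sum_(i < n) Kbar_loc K KL a b h x ((x - X i w) / h).

(* The integrands below are nonnegative, so the integrals over the real line
   are defined (possibly as +oo) as suprema of integrals of simple functions,
   even if KL is not jointly measurable. *)
Definition Vint (R : realType) (K : R -> R) (KL : R -> R -> R) (a b : R)
    (d : measure_display) (T : measurableType d) (P : probability T R)
    (X : nat -> {RV P >-> R}) (n : nat) (h : R) : \bar R :=
  (\int[lebesgue_measure]_x
     variance P (estimator K KL a b X n h x))%E.

Definition Bint (R : realType) (K : R -> R) (KL : R -> R -> R) (a b : R)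
    (d : measure_display) (T : measurableType d) (P : probability T R)
    (X : nat -> {RV P >-> R}) (F : R -> R) (n : nat) (h : R) : \bar R :=
  (\int[lebesgue_measure]_x
     ('E_P[estimator K KL a b X n h x] - (F x)%:E) ^+ 2)%E.

Definition MISE (R : realType) (K : R -> R) (KL : R -> R -> R) (a b : R)
    (d : measure_display) (T : measurableType d) (P : probability T R)
    (X : nat -> {RV P >-> R}) (F : R -> R) (n : nat) (h : R) : \bar R :=
  (\int[P]_w \int[lebesgue_measure]_x
     ((estimator K KL a b X n h x w - F x) ^+ 2)%:E)%E.

Definition Vlead (R : realType) (K F : R -> R) (n : nat) (h : R) : R :=
  n%:R^-1 * (\int[lebesgue_measure]_x (F x * (1 - F x)))
  - h / n%:R * (\int[lebesgue_measure]_u (u * Bfun K u)).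

(* [F^`(2)] is the ordinary second derivative; when F is constant off [a, b] and
   C2 on [a, b], it is unspecified at most at a and b, a null set. *)
Definition intF2sq (R : realType) (F : R -> R) : R :=
  \int[lebesgue_measure]_x ((F^`(2))%classic x ^+ 2).

Definition Blead (R : realType) (K F : R -> R) (h : R) : R :=
  h ^+ 4 / 4 * (\int[lebesgue_measure]_u (u ^+ 2 * K u)) ^+ 2 * intF2sq F.

Definition deltaK (R : realType) (K : R -> R) : R :=
  (\int[lebesgue_measure]_u (u * Bfun K u)) `^ (1 / 3) *
  (\int[lebesgue_measure]_u (u ^+ 2 * K u)) `^ (- (2 / 3)).

Definition h_opt (R : realType) (K F : R -> R) (n : nat) : R :=
  deltaK K * (intF2sq F) `^ (- (1 / 3)) * n%:R `^ (- (1 / 3)).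

(* Main.v *)
Require Import Defs.
From HB Require Import structures.
From mathcomp Require Import all_boot all_order all_algebra.
From mathcomp Require Import all_classical all_reals all_analysis.
From mathcomp Require Import measurable_realfun ring lra.

Set Implicit Arguments.
Unset Strict Implicit.
Unset Printing Implicit Defensive.

Import Order.TTheory GRing.Theory Num.Theory.
Import numFieldNormedType.Exports.

Local Open Scope classical_set_scope.
Local Open Scope ring_scope.

(** The variance and the squared bias are integrated separately over the
    interior [a + h, b - h] and over the two boundary zones of length h. For
    any integrable kernel k with primitive kbar, Fubini gives E kbar((x - X) /
    h) = int k(u) F(x - h u) du; since the primitive of B is Kbar^2, first and
    second moments of the summands are both of this form, and a Taylor
    expansion of F under the integral yields the interior terms. On the left
    boundary the moment condition on K^L cancels the terms of order 0 and 1,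
    because F(a) = 0, and the bias is O(h^2 (1 + |mu_0|(alpha))); the right
    boundary is the left one for a + b - X. The zones have length h, hence
    contribute O(h^5) to the squared bias and, as F = O(h) on the left and 1 -
    F = O(h) on the right, O(h^2 / n) to the variance. Nothing guarantees that
    the integrands over the boundary zones are measurable in x; the integrals
    of nonnegative functions are monotone nevertheless, and this suffices. *)

(** * Lebesgue integrals *)

(** The obstacle is that [KL] is controlled only through [absmu0], which may be unbounded in alpha,
    so the pointwise bounds in the boundary zones are not uniform in x. They are kept as a power of
    h times a multiple of 1 + |mu_0|(alpha)^2; as alpha = (x - a) / h, integrating over a zone
    returns one more factor h times a finite constant. On the left, with alpha h = x - a, the moment
    condition turns the terms of order 0 and 1 of the bias into -(1 - mu_0) (F(x) - (x - a) F'(x));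
    since F(a) = 0, the second factor is up to sign the Taylor remainder at a of the expansion about
    x, hence O(h^2). The coefficient of h / n does not depend on F because F' integrates to F(b - h)
    - F(a + h) = 1 + O(h) over the interior. A bound on F'' is enough for the variance, whereas
    o(h^4) for the squared bias uses the uniform continuity of F''. *)

Lemma integrable_measurable (d : measure_display) (T : measurableType d)
    (R : realType) (m : {measure set T -> \bar R}) (D : set T) (k : T -> R) :
  m.-integrable D (EFin \o k) -> measurable_fun D k.
Proof. by move=> ik; apply/measurable_EFinP; exact: measurable_int ik. Qed.

(** Holds without integrability; it carries results on nonnegative integrands over to signed
    ones. *)
Lemma integral_posneg (d : measure_display) (T : measurableType d)
    (R : realType) (m : {measure set T -> \bar R}) (f : T -> R) :
  (\int[m]_x (f x)%:E =
    \int[m]_x (Num.max (f x) 0)%:E - \int[m]_x (Num.max (- f x) 0)%:E)%E.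
Proof.
rewrite integralE; congr (_ - _)%E; apply: eq_integral => t _.
- by rewrite funeposE/= EFin_max.
- by rewrite funenegE/= EFin_max.
Qed.

Section integral_sandwich.
Context (d : measure_display) (T : measurableType d) (R : realType).
Variable mu : {measure set T -> \bar R}.
Import HBNNSimple.

Lemma ge0_le_integral_nonmeasurable (f g : T -> \bar R) :
  (forall x, (0 <= f x)%E) -> (forall x, (f x <= g x)%E) ->
  (\int[mu]_x f x <= \int[mu]_x g x)%E.
Proof.
move=> f0 fg; have g0 x : (0 <= g x)%E by exact: le_trans (fg x).
rewrite !ge0_integralTE//; apply: le_ereal_sup => _ [k /= kf <-].
by exists k => //= x; exact: le_trans (fg x).
Qed.

(* The integral of a nonnegative, possibly nonmeasurable, function is the
   supremum of the integrals of the simple functions below it, hence it is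
   monotone. *)
Lemma integral_sandwich (v : T -> \bar R) (l u : T -> R) :
  mu.-integrable [set: T] (EFin \o l) -> mu.-integrable [set: T] (EFin \o u) ->
  (forall x, (0 <= v x)%E) -> (forall x, ((l x)%:E <= v x <= (u x)%:E)%E) ->
  [/\ (\int[mu]_x v x)%E \is a fin_num,
      \int[mu]_x l x <= fine (\int[mu]_x v x)%E &
      fine (\int[mu]_x v x)%E <= \int[mu]_x u x].
Proof.
move=> il iu v0 lvu.
have lv x : ((l x)%:E <= v x)%E by have /andP[] := lvu x.
have vu x : (v x <= (u x)%:E)%E by have /andP[] := lvu x.
have fu := integrable_fin_num measurableT iu.
have fl := integrable_fin_num measurableT il.
have up := ge0_le_integral_nonmeasurable v0 vu.
have vfin : (\int[mu]_x v x)%E \is a fin_num.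
  rewrite ge0_fin_numE ?integral_ge0//; apply: le_lt_trans up _.
  by rewrite -ge0_fin_numE// integral_ge0// => x _; exact: le_trans (vu x).
split=> //; last by rewrite fine_le.
(* The minorant [l] may be negative; monotonicity is applied to its positive part, which is still
   below [v]. *)
have il' : mu.-integrable [set: T] (EFin \o (fun x => Num.max (l x) 0)).
  apply: (le_integrable measurableT _ _ il) => //.
    apply/measurable_EFinP; apply: measurable_maxr => //.
    exact: integrable_measurable il.
  by move=> x _ /=; rewrite lee_fin ger0_norm ?le_max ?lexx ?orbT// ge_max
    ler_norm normr_ge0.
have low : (\int[mu]_x (Num.max (l x) 0)%:E <= \int[mu]_x v x)%E.
  apply: ge0_le_integral_nonmeasurable => x;
    first by rewrite lee_fin le_max lexx orbT.
  by rewrite EFin_max ge_max lv v0.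
apply: (@le_trans _ _ (\int[mu]_x (Num.max (l x) 0))).
  by apply: le_Rintegral => // x _; rewrite le_max lexx.
by apply: fine_le => //; exact: integrable_fin_num il'.
Qed.

End integral_sandwich.

(** * Affine change of variables *)

Section affine_change.
Context (R : realType).
Local Notation mu := (@lebesgue_measure R).
Local Notation RR := (measurableTypeR R).

Lemma measurable_affine (c e : R) :
  measurable_fun [set: R] (fun x : R => c * x + e).
Proof. by apply: measurable_funD => //; exact: measurable_funM. Qed.

Let affine (c e : R) : RR -> RR := fun x => c * x + e.

Let scaled (c e : R) : {measure set RR -> \bar R} :=
  mscale (NngNum (normr_ge0 c))
    (measure_function_pushforward__canonical__measure_function_Measure mu
       (measurable_affine c e : measurable_fun _ (affine c e))).

(** By uniqueness of Lebesgue measure it is enough to compare on intervals ]p, q]. For c < 0 the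
    preimage is closed on the left and open on the right, with the same length. *)
Let lebesgue_measure_affine (c e : R) (c0 : c != 0) (A : set RR) :
  measurable A -> mu A = scaled c e A.
Proof.
move=> mA; apply: (@lebesgue_measure_unique R (scaled c e)) => //
  X [[p q] _ <-].
rewrite lebesgue_measure_itv/= lte_fin /scaled /mscale/= /pushforward /affine.
have [c_gt0|c_lt0|/eqP] := ltgtP 0 c; last by rewrite eq_sym (negbTE c0).
- have -> : (fun x => c * x + e) @^-1` `]p, q]%classic =
  `] (p - e) / c, (q - e) / c]%classic.
    apply/seteqP; split => x /=; rewrite !in_itv/= ltr_pdivrMr// ler_pdivlMr//
      [x * c]mulrC => /andP[h1 h2]; apply/andP; split; lra.
  rewrite lebesgue_measure_itv/= lte_fin ltr_pM2r ?invr_gt0// ltrD2r.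
  case: ifP => pq; last by rewrite mule0.
  rewrite -!EFinD -EFinM; congr EFin; rewrite gtr0_norm//; by field.
- have -> : (fun x => c * x + e) @^-1` `]p, q]%classic =
  `[ (q - e) / c, (p - e) / c[%classic.
    apply/seteqP; split => x /=; rewrite !in_itv/= ltr_ndivlMr// ler_ndivrMr//
      [x * c]mulrC => /andP[h1 h2]; apply/andP; split; lra.
  rewrite lebesgue_measure_itv/= lte_fin ltr_nM2r ?invr_lt0// ltrD2r.
  case: ifP => pq; last by rewrite mule0.
  rewrite -!EFinD -EFinM; congr EFin; rewrite ltr0_norm//; by field.
Qed.

Lemma ge0_integral_affine (c e : R) (g : R -> R) : c != 0 ->
  measurable_fun [set: R] g -> (forall x, 0 <= g x) ->
  (\int[mu]_x (g x)%:E = `|c|%:E * \int[mu]_x (g (c * x + e)%R)%:E)%E.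
Proof.
move=> c0 mg g0.
have mEg : measurable_fun [set: RR] (EFin \o g) by exact/measurable_EFinP.
rewrite (@eq_measure_integral _ _ _ _ (scaled c e)); last first.
  by move=> A mA _; first [exact: lebesgue_measure_affine | exact: esym
    (lebesgue_measure_affine _ _ _)].
rewrite ge0_integral_mscale//=; last first.
  by move=> x _; rewrite lee_fin.
congr (_ * _)%E; rewrite ge0_integral_pushforward//.
- exact: measurable_affine.
- by move=> x _; rewrite lee_fin.
Qed.

End affine_change.

(** * Taylor expansion on a segment *)

Section taylor.
Context (R : realType).

(** Near x the difference quotient is within 1 of l, so |g y - g x| <= (|l| + 1) |y - x|. *)
Lemma is_derive_in_cvg (A : set R) (g : R -> R) (x l : R) :
  is_derive_in A g x l -> g y @[y --> within A (nbhs x)] --> g x.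
Proof.
move=> /cvgrPdist_lt/(_ _ ltr01); rewrite near_withinE near_withinE => gl.
apply/cvgrPdist_lt => e e0; rewrite near_withinE.
pose k := `|l| + 1; have k0 : 0 < k by rewrite ltr_wpDl.
near=> y => Ay; have [->|yx] := eqVneq y x; first by rewrite subrr normr0.
have : `|l - (g y - g x) / (y - x)| < 1.
  by have : y != x -> A y -> `|l - (g y - g x) / (y - x)| < 1; [near: y|exact].
have yx0 : y - x != 0 by rewrite subr_eq0.
set q := (g y - g x) / (y - x) => ql.
have -> : g x - g y = - (q * (y - x)) by rewrite /q divfK// opprB.
rewrite normrN normrM.
have qk : `|q| < k.
  rewrite /k -[q](subrK l) addrC; apply: le_lt_trans (ler_normD _ _) _.
  by rewrite ltrD2l distrC.
have ye : `|y - x| < e / k.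
  near: y; exists (e / k) => /=; first exact: divr_gt0.
  by move=> z /=; rewrite distrC.
by rewrite -(divfK (lt0r_neq0 k0) e) mulrC ltr_pM// normr_ge0.
Unshelve. all: by end_near. Qed.

Lemma is_derive_in_within (A : set R) (g g' : R -> R) :
  (forall x, A x -> is_derive_in A g x (g' x)) -> {within A, continuous g}.
Proof. by move=> dg; apply/subspace_continuousP => x /dg/is_derive_in_cvg. Qed.

(** An interior point has a neighbourhood inside [[a, b]], so the relative limit is the two-sided
    one. *)
Lemma is_derive_in_itv (a b : R) (g : R -> R) (x l : R) : x \in `]a, b[ ->
  is_derive_in `[a, b] g x l -> is_derive x 1 g l.
Proof.
move=> xab gl.
have gl0 : h^-1 *: (g (h *: 1 + x) - g x) @[h --> 0^'] --> l.
  move/cvgrPdist_lt : gl => gl; apply/cvgrPdist_lt => e /gl.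
  rewrite !near_withinE => gle.
  have : \forall h \near (0 : R), h + x != x -> `[a, b]%classic (h + x) ->
     `|l - (g (h + x) - g x) / (h + x - x)| < e.
    have shx : (h + x) @[h --> (0 : R)] --> x.
      rewrite -[X in _ --> X](add0r x); apply: cvgD;
        [exact: cvg_id|exact: cvg_cst].
    exact: shx gle.
  have : \forall h \near (0 : R), `[a, b]%classic (h + x).
    have shx : (h + x) @[h --> (0 : R)] --> x.
      rewrite -[X in _ --> X](add0r x); apply: cvgD;
        [exact: cvg_id|exact: cvg_cst].
    apply: shx; have : \forall y \near x, y \in `]a, b[ by exact: near_in_itvoo.
    by apply: filterS => y; rewrite /= !in_itv/= => /andP[/ltW -> /ltW ->].
  apply: filterS2 => h hab hlt h0.
  rewrite /GRing.scale/= mulr1 mulrC.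
  by have := hlt _ hab; rewrite addrK; apply; rewrite -subr_eq0 addrK.
have dg : derivable g x 1 by apply/cvg_ex; exists l.
by apply: DeriveDef => //; apply/cvg_lim.
Qed.

(* Taylor-Lagrange by Rolle's theorem applied to
   t |-> g t + (y - t) g1 t + (y - t)^2 k, with k such that it takes the same
   value at x and y. *)
Let taylor_rolle (a b p q x y : R) (g g1 g2 : R -> R) :
  (forall t, t \in `[a, b] -> is_derive_in `[a, b] g t (g1 t)) ->
  (forall t, t \in `[a, b] -> is_derive_in `[a, b] g1 t (g2 t)) ->
  a <= p -> p < q -> q <= b -> (x = p /\ y = q) \/ (x = q /\ y = p) ->
  exists2 z, z \in `]p, q[ &
    g y = g x + (y - x) * g1 x + (y - x) ^+ 2 / 2 * g2 z.
Proof.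
move=> dg dg1 ap pq qb xy.
have yx0 : y - x != 0 by rewrite subr_eq0; case: xy => -[-> ->]; lra.
pose k := (g y - g x - (y - x) * g1 x) / (y - x) ^+ 2.
pose f := fun t : R => g t + (y - t) * g1 t + (y - t) ^+ 2 * k.
have sub t : t \in `]p, q[ -> t \in `]a, b[.
  by rewrite !in_itv/= => /andP[h1 h2]; apply/andP; split; lra.
have df t : t \in `]p, q[ ->
    is_derive t 1 f ((y - t) * (g2 t - 2 * k)).
  move=> /sub tab; have tab' : t \in `[a, b] by exact: subset_itv_oo_cc.
  have i1 := is_derive_in_itv tab (dg _ tab').
  have i2 := is_derive_in_itv tab (dg1 _ tab').
  have i3 : is_derive t 1 (fun t : R => y - t) (-1).
    have -> : (fun t : R => y - t) = cst y - id by apply/funext.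
    apply: is_derive_eq; by rewrite sub0r.
  have -> : f = g + (fun t => y - t) * g1 + (fun t => y - t) * (fun t =>
    y - t) * cst k.
    by apply/funext => u; rewrite /f !fctE expr2.
  have i4 := is_deriveD (is_deriveD i1 (is_deriveM i3 i2))
    (is_deriveM (is_deriveM i3 i3) (is_derive_cst k t 1)).
  apply: is_derive_eq i4 _; rewrite !fctE /GRing.scale/=; ring.
have cg := is_derive_in_within (A := `[a, b]%classic) (g' :=
  g1) (fun t h => dg t h).
have cg1 := is_derive_in_within (A := `[a, b]%classic) (g' :=
  g2) (fun t h => dg1 t h).
have spq : `[p, q]%classic `<=` `[a, b]%classic.
  by apply: subset_itvScc; rewrite bnd_simp.
have cf : {within `[p, q], continuous f}.
  have c1 : continuous (g : subspace `[p, q] -> R) :=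
    continuous_subspaceW spq cg.
  have c2 : continuous (g1 : subspace `[p, q] -> R) :=
    continuous_subspaceW spq cg1.
  have c3 : continuous ((fun t => y - t) : subspace `[p, q] -> R).
    apply: continuous_subspaceT => t; apply: cvgB;
      [exact: cvg_cst|exact: cvg_id].
  move=> t; apply: cvgD; first by apply: cvgD; [exact: c1|apply: cvgM;
    [exact: c3|exact: c2]].
  by apply: cvgM; [apply: cvgM; exact: c3|exact: cvg_cst].
have fxy : f x = f y.
  by rewrite /f /k !subrr expr0n/= !mul0r !addr0; field; exact: yx0.
have fpq : f p = f q by case: xy => -[<- <-].
have [z zpq dz] := Rolle pq (fun t h => ex_derive (is_derive := df t h)) cf fpq.
exists z => //.
have : (y - z) * (g2 z - 2 * k) = 0.
  by rewrite -(@derive_val _ _ _ _ _ _ _ dz) (@derive_val _ _ _ _ _ _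
    _ (df z zpq)).
have yz : y - z != 0.
  by move: zpq; rewrite in_itv/= subr_eq0 => /andP[h1 h2];
    case: xy => -[_ ->]; lra.
move/eqP; rewrite mulf_eq0 (negbTE yz)/= subr_eq0 => /eqP ->.
rewrite /k; field; exact: yx0.
Qed.

(** Locating z by |z - x| <= |y - x| covers both orders of x and y, and is the form in which a
    modulus of continuity of [g2] at x can be applied. *)
Lemma taylor_lagrange (a b x y : R) (g g1 g2 : R -> R) :
  (forall t, t \in `[a, b] -> is_derive_in `[a, b] g t (g1 t)) ->
  (forall t, t \in `[a, b] -> is_derive_in `[a, b] g1 t (g2 t)) ->
  x \in `[a, b] -> y \in `[a, b] ->
  exists z, [/\ z \in `[a, b], `|z - x| <= `|y - x| &
    g y = g x + (y - x) * g1 x + (y - x) ^+ 2 / 2 * g2 z].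
Proof.
move=> dg dg1; rewrite !in_itv/= => /andP[ax xb] /andP[ay yb].
have [xy|yx|<-] := ltgtP x y.
- have [z /[!in_itv]/= /andP[h1 h2] e] :=
  taylor_rolle dg dg1 ax xy yb (or_introl (conj erefl erefl)).
  exists z; split => //; first by rewrite in_itv/=; apply/andP; split; lra.
  by rewrite !ger0_norm; lra.
- have [z /[!in_itv]/= /andP[h1 h2] e] :=
  taylor_rolle dg dg1 ay yx xb (or_intror (conj erefl erefl)).
  exists z; split => //; first by rewrite in_itv/=; apply/andP; split; lra.
  by rewrite !ltr0_norm; lra.
- exists x; split => //; first by rewrite in_itv/= ax.
  by rewrite subrr expr0n/= !mul0r !addr0.
Qed.

(** Around each x, half of its radius of continuity serves all nearby points; compactness, in its
    near-covering form, replaces these local radii by a single one. *)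
Lemma heine (A : set R) (g : R -> R) (e : R) : compact A ->
  {within A, continuous g} -> 0 < e ->
  exists2 r, 0 < r & forall x y, A x -> A y -> `|y - x| < r ->
    `|g y - g x| <= e.
Proof.
move=> /compact_near_coveringP cA /subspace_continuousP cg e0.
have := cA _ (0 : R)^'+ (fun r x => forall y, A y -> `|y - x| < r -> A x ->
  `|g y - g x| <= e).
move=> /(_ _ _)[].
  move=> x Ax; have e2 : 0 < e / 2 by exact: divr_gt0.
  have /cvgrPdist_lt/(_ _ e2) := cg _ Ax; rewrite near_withinE => -[r /= r0 rg].
  have r2 : 0 < r / 2 by exact: divr_gt0.
  exists (ball x (r / 2), [set s | s < r / 2]) => /=.
    split; first exact: nbhsx_ballx.
    exact: nbhs_right_lt.
  move=> [z s] [/= xz sr] y Ay yzs Az.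
  have h1 : `|g x - g z| < e / 2.
    by apply: rg => //=; apply: lt_trans xz _; rewrite gtr_pMr ?invf_lt1 ?ltr1n.
  have h2 : `|g x - g y| < e / 2.
    apply: rg => //=; have -> : x - y = (x - z) - (y - z) by ring.
    apply: le_lt_trans (ler_normB _ _) _; rewrite (splitr r) ltrD//.
    exact: lt_trans sr.
  have -> : g y - g z = (g x - g z) - (g x - g y) by ring.
  apply: le_trans (ler_normB _ _) _; rewrite (splitr e) lerD//; exact: ltW.
move=> r /= r0 rP; exists (r / 2); first exact: divr_gt0.
move=> x y Ax Ay yx; apply: (rP (r / 2)) => //=.
- rewrite sub0r normrN gtr0_norm ?divr_gt0//.
  by rewrite gtr_pMr ?invf_lt1 ?ltr1n.
- exact: divr_gt0.
Qed.

Lemma compact_continuous_bounded (A : set R) (g : R -> R) : compact A ->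
  {within A, continuous g} -> exists2 M, 0 < M & forall x, A x -> `|g x| <= M.
Proof.
move=> cA cg; have /compact_bounded/ex_strict_bound_gt0[M M0 Mg] :=
  continuous_compact cg cA.
by exists M => // x Ax; apply: ltW; apply: Mg; exists x.
Qed.

End taylor.

(** * Moments and Taylor expansion under the integral sign *)

Section moments.
Context (R : realType).
Local Notation mu := (@lebesgue_measure R).

Lemma integrable_mul_bounded (d : measure_display) (T : measurableType d)
    (m : {measure set T -> \bar R}) (k g : T -> R) (C : R) :
  m.-integrable [set: T] (EFin \o k) -> measurable_fun [set: T] g ->
  (forall x, `|g x| <= C) ->
    m.-integrable [set: T] (EFin \o (fun x => k x * g x)).
Proof.
move=> ik mg gC.
have := integrableMl measurableT ik mg; apply.
by exists C; split; [exact: num_real|move=> t Ct x _;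
  exact: le_trans (gC x) (ltW Ct)].
Qed.

Lemma integrable_moment (k : R -> R) (j : nat) :
  mu.-integrable [set: R] (EFin \o k) -> (forall u, k u != 0 -> `|u| <= 1) ->
  mu.-integrable [set: R] (EFin \o (fun u => u ^+ j * k u)).
Proof.
move=> ik k1; apply: (le_integrable measurableT _ _ ik) => //.
  apply/measurable_EFinP; apply: measurable_funM; first exact: measurable_funX.
  exact: integrable_measurable ik.
move=> u _ /=; rewrite lee_fin normrM normrX.
have [->|/k1 u1] := eqVneq (k u) 0; first by rewrite normr0 mulr0.
by rewrite ler_piMl// exprn_ile1.
Qed.

(** Applied with [k] equal to K, B or a boundary kernel, and [g] a distribution function. The
    expansion of [g] is required only where [k] is nonzero, since [g] need not be smooth across the
    end points a and b. With c = 0 it is a first order expansion in which e bounds the second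
    derivative; otherwise e bounds the oscillation of that derivative. *)
Lemma weighted_taylor (k g : R -> R) (x h g1 c e : R) :
  mu.-integrable [set: R] (EFin \o k) -> (forall u, k u != 0 -> `|u| <= 1) ->
  measurable_fun [set: R] g -> (forall t, `|g t| <= 1) -> 0 <= e ->
  (forall u, k u != 0 ->
    `|g (x - h * u) - g x + h * u * g1 - (h * u) ^+ 2 / 2 * c| <=
      e * ((h * u) ^+ 2 / 2)) ->
  `|\int[mu]_u (k u * g (x - h * u)) -
     (g x * (\int[mu]_u k u) - h * g1 * (\int[mu]_u (u * k u))
      + h ^+ 2 / 2 * c * (\int[mu]_u (u ^+ 2 * k u)))|
  <= e * h ^+ 2 / 2 * \int[mu]_u `|k u|.
Proof.
move=> ik k1 mg gb e0 ke.
have ikg : mu.-integrable [set: R] (EFin \o (fun u => k u * g (x - h * u))).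
  apply: (integrable_mul_bounded (C := 1)) => //.
  apply: measurableT_comp => //; have := measurable_affine (- h) x.
  by under eq_fun do rewrite mulNr addrC.
have i1 : mu.-integrable [set: R] (EFin \o (fun u => u * k u)).
  exact: (integrable_moment 1 ik k1).
have i2 := integrable_moment 2 ik k1.
have iZ (r : R) (f : R -> R) : mu.-integrable [set: R] (EFin \o f) ->
    mu.-integrable [set: R] (EFin \o (fun u => r * f u)).
  by move=> if_; apply: (integrableZl measurableT r if_).
have iB (f f' : R -> R) : mu.-integrable [set: R] (EFin \o f) ->
    mu.-integrable [set: R] (EFin \o f') ->
    mu.-integrable [set: R] (EFin \o (fun u => f u - f' u)).
  by move=> if_ if'; apply: (integrableB measurableT if_ if').
have iD (f f' : R -> R) : mu.-integrable [set: R] (EFin \o f) ->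
    mu.-integrable [set: R] (EFin \o f') ->
    mu.-integrable [set: R] (EFin \o (fun u => f u + f' u)).
  by move=> if_ if'; apply: (integrableD measurableT if_ if').
pose A u := g x * k u - h * g1 * (u * k u).
pose L u := A u + h ^+ 2 / 2 * c * (u ^+ 2 * k u).
have iA : mu.-integrable [set: R] (EFin \o A) by apply: iB; exact: iZ.
have iL : mu.-integrable [set: R] (EFin \o L) by apply: iD => //; exact: iZ.
have iabs : mu.-integrable [set: R] (EFin \o (fun u => `|k u|))
  by exact: integrable_norm.
have -> : g x * (\int[mu]_u k u) - h * g1 * (\int[mu]_u (u * k u))
      + h ^+ 2 / 2 * c * (\int[mu]_u (u ^+ 2 * k u)) = \int[mu]_u L u.
  rewrite RintegralD//; last exact: iZ.
  by rewrite RintegralB//; [rewrite !RintegralZl//|exact: iZ|exact: iZ].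
rewrite -RintegralB//.
apply: le_trans (le_normr_Rintegral measurableT (iB _ _ ikg iL)) _.
rewrite -RintegralZl//; apply: le_Rintegral => //.
- exact: (integrable_norm (iB _ _ ikg iL)).
- exact: iZ.
move=> u _; rewrite /L /A.
have [->|k0] := eqVneq (k u) 0.
  by rewrite !mulr0 mul0r subr0 addr0 subr0 normr0 mulr0.
have -> : k u * g (x - h * u) - (g x * k u - h * g1 * (u * k u) + h ^+ 2 / 2 *
  c * (u ^+ 2 * k u))
  = k u * (g (x - h * u) - g x + h * u * g1 - (h * u) ^+ 2 / 2 * c) by ring.
rewrite normrM mulrC ler_wpM2r//; apply: le_trans (ke _ k0) _.
rewrite -mulrA ler_wpM2l// exprMn ler_wpM2r ?invr_ge0//.
rewrite ler_piMr ?sqr_ge0// -real_normK ?num_real// exprn_ile1//; exact: k1.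
Qed.

Lemma integrable_affine (c e : R) (g : R -> R) : c != 0 ->
  mu.-integrable [set: R] (EFin \o g) ->
  mu.-integrable [set: R] (EFin \o (fun x => g (c * x + e))).
Proof.
move=> c0 ig; have mg :
  measurable_fun [set: R] g by exact: integrable_measurable ig.
apply/integrableP; split.
  by apply/measurable_EFinP; apply: measurableT_comp => //;
    exact: measurable_affine.
move/integrableP : ig => [_] /=.
rewrite (ge0_integral_affine e c0 (g := fun x => `|g x|))//;
  last exact: measurableT_comp.
have [->|oo] := eqVneq (\int[mu]_x `|g (c * x + e)|%:E)%E +oo%E.
  by rewrite gt0_muley// lte_fin normr_gt0.
by move=> _; rewrite ltey.
Qed.

Lemma integral_affine (c e : R) (g : R -> R) : c != 0 ->
  mu.-integrable [set: R] (EFin \o g) ->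
  \int[mu]_x g x = `|c| * \int[mu]_x g (c * x + e).
Proof.
move=> c0 ig; have mg :
  measurable_fun [set: R] g by exact: integrable_measurable ig.
have iga := integrable_affine e c0 ig.
rewrite /Rintegral.
have h1 := integrable_fin_num measurableT ig.
have h2 := integrable_fin_num measurableT iga.
apply/EFin_inj; rewrite EFinM !fineK//.
rewrite (integral_posneg mu g) (integral_posneg mu (fun x => g (c * x + e))).
rewrite (ge0_integral_affine e c0 (g := fun x => Num.max (g x) 0));
  last 2 first.
- exact: measurable_maxr.
- by move=> t; rewrite le_max lexx orbT.
rewrite (ge0_integral_affine e c0 (g := fun x => Num.max (- g x) 0));
  last 2 first.
- by apply: measurable_maxr => //; exact: measurable_funN.
- by move=> t; rewrite le_max lexx orbT.
rewrite [RHS]muleBr//; apply: fin_num_adde_defr.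
have := integrable_fin_num measurableT (integrable_funepos measurableT iga).
by congr (_ \is a fin_num); apply: eq_integral => t _;
  rewrite funeposE/= EFin_max.
Qed.

End moments.

(** * Integration over the interior and the boundary zones *)

Lemma normB_le_between (R : realFieldType) (v p m e c : R) :
  p - m <= v -> v <= p + m + c -> m <= e -> 0 <= c -> `|v - p| <= e + c.
Proof. by rewrite ler_norml => *; apply/andP; split; lra. Qed.

Section interior_boundary.
Context (R : realType).
Local Notation mu := (@lebesgue_measure R).

Lemma integrable_restrict (d : measure_display) (T : measurableType d)
    (m : {measure set T -> \bar R}) (A : set T) (g : T -> R) : measurable A ->
  m.-integrable A (EFin \o g) -> m.-integrable [set: T] (EFin \o (g \_ A)).
Proof. by move=> mA; rewrite -restrict_EFin => /(integrable_mkcond _ mA). Qed.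

Section sandwich.
Variables (a b h c E : R) (v : R -> \bar R) (phi bw : R -> R).
Local Notation mid := (`[a + h, b - h]%classic : set R).
Hypothesis h0 : 0 < h <= (b - a) / 2.
Hypothesis iphi : mu.-integrable mid (EFin \o phi).
Hypothesis ibw : mu.-integrable [set: R] (EFin \o bw).
Hypothesis bw0 : forall x, 0 <= bw x.
Hypothesis c0 : 0 <= c.
Hypothesis E0 : 0 <= E.
Hypothesis v0 : forall x, (0 <= v x)%E.
Hypothesis vout : forall x, ~~ (a < x < b) -> v x = 0%E.
Hypothesis vmid : forall x, a + h <= x <= b - h ->
  ((phi x - E)%:E <= v x <= (phi x + E)%:E)%E.
Hypothesis vleft : forall x, a < x < a + h -> (v x <= (c * bw x)%:E)%E.
Hypothesis vright : forall x, b - h < x < b -> (v x <= (c * bw x)%:E)%E.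

(** [v] is squeezed between [phi] - E on [mid], extended by 0, and [phi] + E on [mid] plus [c] times
    [bw]; only these two functions have to be integrable. The lemma serves four times: for the
    variance, the squared bias, F (1 - F) and the square of F''. *)
Lemma integral_interior_boundary :
  (\int[mu]_x v x)%E \is a fin_num /\
  `|fine (\int[mu]_x v x)%E - \int[mu]_(x in mid) phi x| <=
     E * (b - a) + c * \int[mu]_x bw x.
Proof.
case/andP: h0 => hp hab.
have mmid : measurable (mid : set (measurableTypeR R)) by exact: measurable_itv.
have iE : mu.-integrable mid (EFin \o cst E).
  apply: measurable_bounded_integrable => //.
    by rewrite /= lebesgue_measure_itv; case: ifP => // _; rewrite ltry.
  by exists E; split; [exact: num_real|move=> t Et x _ /=;
    rewrite ger0_norm// ltW].
pose l := (fun x => phi x - E) \_ mid.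
pose u0 := (fun x => phi x + E) \_ mid.
pose u x := u0 x + c * bw x.
have il : mu.-integrable [set: R] (EFin \o l).
  by apply: integrable_restrict => //; exact: (integrableB mmid iphi iE).
have iu0 : mu.-integrable [set: R] (EFin \o u0).
  by apply: integrable_restrict => //; exact: (integrableD mmid iphi iE).
have icb : mu.-integrable [set: R] (EFin \o (fun x => c * bw x)) :=
  integrableZl measurableT c ibw.
have iu : mu.-integrable [set: R] (EFin \o u) :=
  integrableD measurableT iu0 icb.
have cb0 x : 0 <= c * bw x by exact: mulr_ge0.
have lvu x : ((l x)%:E <= v x <= (u x)%:E)%E.
  rewrite /u /l /u0 !patchE mem_setE in_itv/=; case: ifPn => [xm|xm].
    have /andP[-> /=] := vmid xm; move/le_trans; apply.
    by rewrite lee_fin lerDl.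
  rewrite v0 add0r/=; have [/andP[ax xb]|/vout ->] := boolP (a < x < b);
    last by rewrite lee_fin.
  move: xm; rewrite negb_and -!ltNge => /orP[xl|xr].
    by apply: vleft; rewrite ax.
  by apply: vright; rewrite xr.
have [vfin vl vu] := integral_sandwich il iu v0 lvu; split=> //.
have mE : \int[mu]_(x in mid) E <= E * (b - a).
  rewrite Rintegral_cst// ler_wpM2l//= lebesgue_measure_itv/= lte_fin.
  case: ifP => _ /=; last by lra.
  by lra.
have el : \int[mu]_x l x = \int[mu]_(x in mid) phi x - \int[mu]_(x in mid) E.
  by rewrite -Rintegral_mkcond RintegralB.
have eu : \int[mu]_x u x =
  \int[mu]_(x in mid) phi x + \int[mu]_(x in mid) E + c * \int[mu]_x bw x.
  by rewrite RintegralD// -Rintegral_mkcond RintegralD// RintegralZl.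
have cI : 0 <= c * \int[mu]_x bw x by rewrite mulr_ge0// Rintegral_ge0.
by rewrite el in vl; rewrite eu in vu; exact: normB_le_between vl vu mE cI.
Qed.
End sandwich.

Section boundary_weight.
Variables (a b h : R) (rho : R -> R).
Hypothesis h0 : 0 < h.
Hypothesis rho0 : forall u, 0 <= rho u.
Hypothesis irho : mu.-integrable `]0, 1[ (EFin \o rho).

Let w := rho \_ `]0, 1[%classic.

(** Each zone carries a copy of [rho], stretched from ]0, 1[ to length h by the change of variables
    that defines alpha; this is the source of the factor h in every boundary contribution. *)
Definition boundary_weight (x : R) : R := w ((x - a) / h) + w ((b - x) / h).

Let iw : mu.-integrable [set: R] (EFin \o w).
Proof. exact: integrable_restrict. Qed.

Let wl : (fun x => w ((x - a) / h)) = (fun x => w (h^-1 * x + - a / h)).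
Proof. by apply/funext => x; congr w; ring. Qed.

Let wr : (fun x => w ((b - x) / h)) = (fun x => w (- h^-1 * x + b / h)).
Proof. by apply/funext => x; congr w; ring. Qed.

Let hV : h^-1 != 0. Proof. by rewrite invr_eq0 lt0r_neq0. Qed.
Let hVN : - h^-1 != 0. Proof. by rewrite oppr_eq0. Qed.

Let iwl : mu.-integrable [set: R] (EFin \o (fun x => w ((x - a) / h))).
Proof. by rewrite wl; exact: integrable_affine. Qed.
Let iwr : mu.-integrable [set: R] (EFin \o (fun x => w ((b - x) / h))).
Proof. by rewrite wr; exact: integrable_affine. Qed.

Lemma integrable_boundary_weight :
  mu.-integrable [set: R] (EFin \o boundary_weight).
Proof. exact: (integrableD measurableT iwl iwr). Qed.

Lemma Rintegral_boundary_weight :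
  \int[mu]_x boundary_weight x = 2 * h * \int[mu]_(u in `]0, 1[) rho u.
Proof.
rewrite RintegralD// wl wr [X in 2 * h * X]Rintegral_mkcond -/w.
have := integral_affine (- a / h) hV iw; have := integral_affine (b / h) hVN iw.
rewrite normrN gtr0_norm ?invr_gt0// => e1 e2.
have h1 : \int[mu]_x w (h^-1 * x + - a / h) = h * \int[mu]_u w u.
  by rewrite e2 mulVKf// lt0r_neq0.
have h2 : \int[mu]_x w (- h^-1 * x + b / h) = h * \int[mu]_u w u.
  by rewrite e1 mulVKf// lt0r_neq0.
by rewrite h1 h2; ring.
Qed.

Let w0 u : 0 <= w u. Proof. by rewrite /w patchE; case: ifP. Qed.

Lemma boundary_weight_ge0 x : 0 <= boundary_weight x.
Proof. by rewrite addr_ge0. Qed.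

Lemma boundary_weight_left x : a < x < a + h ->
  rho ((x - a) / h) <= boundary_weight x.
Proof.
move=> /andP[ax xh]; rewrite /boundary_weight {1}/w patchE mem_set ?lerDl//=.
by rewrite in_itv/= divr_gt0 ?subr_gt0//= ltr_pdivrMr// mul1r ltrBlDl.
Qed.

Lemma boundary_weight_right x : b - h < x < b ->
  rho ((b - x) / h) <= boundary_weight x.
Proof.
move=> /andP[xh xb]; rewrite /boundary_weight {2}/w patchE mem_set ?lerDr//=.
by rewrite in_itv/= divr_gt0 ?subr_gt0//= ltr_pdivrMr// mul1r; lra.
Qed.
End boundary_weight.

End interior_boundary.

(** * First and second derivatives of F on [a, b] *)

Section second_derivative.
Context (R : realType).
Local Notation mu := (@lebesgue_measure R).
Variables (a b : R) (F g1 g2 : R -> R).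
Hypothesis hab : a < b.
Hypothesis dF : forall t, t \in `[a, b] -> is_derive_in `[a, b] F t (g1 t).
Hypothesis dg1 : forall t, t \in `[a, b] -> is_derive_in `[a, b] g1 t (g2 t).
Hypothesis cg2 : {within `[a, b], continuous g2}.

Let dF1 x : x \in `]a, b[ -> is_derive x 1 F (g1 x).
Proof. by move=> xab; apply: (is_derive_in_itv xab); apply: dF;
  exact: subset_itv_oo_cc. Qed.

Let dg1' x : x \in `]a, b[ -> is_derive x 1 g1 (g2 x).
Proof. by move=> xab; apply: (is_derive_in_itv xab); apply: dg1;
  exact: subset_itv_oo_cc. Qed.

Lemma C2_continuous0 : {within `[a, b], continuous F}.
Proof. exact: is_derive_in_within (fun t h => dF h). Qed.

Lemma C2_continuous1 : {within `[a, b], continuous g1}.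
Proof. exact: is_derive_in_within (fun t h => dg1 h). Qed.

(** Used with p = a + h and q = b - h, which coincide when h = (b - a) / 2. Strictly inside [a, b]
    the relative derivative is the ordinary one that the fundamental theorem of calculus asks
    for. *)
Lemma Rintegral_derivative_itv (p q : R) : a < p -> p <= q -> q < b ->
  \int[mu]_(x in `[p, q]) g1 x = F q - F p.
Proof.
move=> ap; rewrite le_eqVlt => /predU1P[<-|pq] qb.
  by rewrite set_itv1 Rintegral_set1 subrr.
have sub x : x \in `[p, q] -> x \in `]a, b[.
  by rewrite !in_itv/= => /andP[px xq];
    rewrite (lt_le_trans ap px) (le_lt_trans xq qb).
have dFx x : x \in `[p, q] -> derivable F x 1 by move=> /sub/dF1[].
have cF x : x \in `[p, q] -> {for x, continuous F}.
  by move=> /dFx/derivable1_diffP/differentiable_continuous.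
rewrite /Rintegral (continuous_FTC2 (F := F))//.
- apply: continuous_subspaceW C2_continuous1.
  by apply: subset_itvScc; rewrite bnd_simp ltW.
- split.
  + by move=> x xpq; apply: dFx; exact: subset_itv_oo_cc.
  + by apply: cvg_at_right_filter; apply: cF; rewrite in_itv/= lexx ltW.
  + by apply: cvg_at_left_filter; apply: cF; rewrite in_itv/= lexx ltW.
- move=> x xpq; rewrite derive1E; have := dF1 (sub _ (subset_itv_oo_cc xpq)).
  by move=> ?; rewrite derive_val.
Qed.

Lemma derive1n2_in x : x \in `]a, b[ -> (F^`(2))%classic x = g2 x.
Proof.
move=> xab; rewrite derive1nS derive1n1 derive1E.
rewrite (@near_eq_derive _ _ _ _ g1).
  by have := dg1' xab => ?; rewrite derive_val.
have : \forall y \near x, y \in `]a, b[ by exact: near_in_itvoo.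
by apply: filterS => y yab; rewrite derive1E; have := dF1 yab => ?;
  rewrite derive_val.
Qed.

Hypothesis Fa : forall t, t <= a -> F t = 0.
Hypothesis Fb : forall t, b <= t -> F t = 1.

Let derive1n2_cst (k x : R) : (\forall y \near x, \forall z \near y, F z = k) ->
  (F^`(2))%classic x = 0.
Proof.
move=> Fk; rewrite derive1nS derive1n1 derive1E.
rewrite (@near_eq_derive _ _ _ _ (cst 0)) ?derive_cst//.
by apply: filterS Fk => y Fk; rewrite derive1E (@near_eq_derive _ _ _ _ (cst
  k)) ?derive_cst.
Qed.

Lemma derive1n2_out x : x != a -> x != b -> ~~ (a < x < b) ->
  (F^`(2))%classic x = 0.
Proof.
move=> xa xb; rewrite negb_and -!leNgt => /orP[];
  rewrite le_eqVlt ?(negbTE xa) 1?eq_sym ?(negbTE xb)/= => h.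
  apply: (@derive1n2_cst 0).
  have : \forall y \near x, y \in `]-oo, a[
    by apply: near_in_itvNyo; rewrite in_itv.
  apply: filterS => y ya.
  have : \forall z \near y, z \in `]-oo, a[ by apply: near_in_itvNyo.
  by apply: filterS => z; rewrite in_itv/= => /ltW/Fa.
apply: (@derive1n2_cst 1).
have : \forall y \near x, y \in `]b, +oo[
  by apply: near_in_itvoy; rewrite in_itv/= andbT.
apply: filterS => y ya.
have : \forall z \near y, z \in `]b, +oo[ by apply: near_in_itvoy.
by apply: filterS => z; rewrite in_itv/= andbT => /ltW/Fb.
Qed.

Lemma measurable_within (g : R -> R) : {within `[a, b], continuous g} ->
  measurable_fun (`[a, b]%classic : set R) g.
Proof. by move=> cg; apply: subspace_continuous_measurable_fun. Qed.

Lemma intF2sqE : intF2sq F = \int[mu]_(x in `]a, b[) (g2 x ^+ 2).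
Proof.
rewrite /intF2sq [RHS]Rintegral_mkcond.
have mg : measurable_fun [set: R] ((fun x => g2 x ^+ 2) \_ `]a, b[).
  apply/(measurable_restrictT _ _).1 => //.
  apply: measurable_funX; apply: measurable_funS (measurable_within cg2) => //.
  exact: subset_itv_oo_cc.
pose F2 := (F^`(2))%classic.
have F2E x : x != a -> x != b ->
  F2 x ^+ 2 = ((fun x => g2 x ^+ 2) \_ `]a, b[) x.
  move=> xa xb; rewrite patchE mem_setE;
    have [xab|xab] := boolP (x \in `]a, b[).
    by rewrite /F2 derive1n2_in.
  by rewrite /F2 derive1n2_out ?expr0n//; move: xab; rewrite in_itv.
congr fine; apply: ae_eq_integral => //; last 2 first.
- exact/measurable_EFinP.
- exists [set a; b]; split.
  + by apply: measurableU; exact: measurable_set1.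
  + apply/eqP; rewrite eq_le measure_ge0 andbT.
    apply: le_trans (measureU2 _ _ _) _;
      [exact: measurable_set1|exact: measurable_set1|].
    by rewrite /= !lebesgue_measure_set1 adde0.
  + move=> x /= /not_implyP[_ /= h];
    apply/not_notP => /not_orP[/eqP xa /eqP xb].
    by apply: h; congr EFin; exact: F2E.
apply/measurable_EFinP.
(* The values at a and b are unknown, but a function that agrees off two points with a measurable
   one is measurable. *)
have -> : (fun x => F2 x ^+ 2) = fun x => if x == a then F2 a ^+ 2 else
    if x == b then F2 b ^+ 2 else ((fun x => g2 x ^+ 2) \_ `]a, b[) x.
  apply/funext => x; have [->|xa] := eqVneq x a; first by [].
  have [->|xb] := eqVneq x b; first by [].
  exact: F2E.
apply: measurable_fun_ifT => //; first exact: measurable_fun_eqr.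
by apply: measurable_fun_ifT => //; exact: measurable_fun_eqr.
Qed.

End second_derivative.

(** * Parameter integrals and Fubini's theorem under a product bound *)

Section fubini.
Context d1 d2 (T1 : measurableType d1) (T2 : measurableType d2) (R : realType).

(** No integrability is assumed: Tonelli applies to the positive and the negative part, and their
    difference and [fine] are measurable even at infinite values. *)
Lemma measurable_Rintegral_param (m2 : {sigma_finite_measure set T2 -> \bar R})
    (f : T1 * T2 -> R) : measurable_fun [set: T1 * T2] f ->
  measurable_fun [set: T1] (fun x => \int[m2]_y f (x, y)).
Proof.
move=> mf; rewrite /Rintegral; apply: measurableT_comp => //.
under eq_fun do rewrite integral_posneg.
apply: emeasurable_funB.
- apply: (measurable_fun_fubini_tonelli_F (m2 :=
  m2) (fun z => (Num.max (f z) 0)%:E)).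
    by apply/measurable_EFinP; exact: measurable_maxr.
  by move=> z; rewrite lee_fin le_max lexx orbT.
- apply: (measurable_fun_fubini_tonelli_F (m2 :=
  m2) (fun z => (Num.max (- f z) 0)%:E)).
    by apply/measurable_EFinP; apply: measurable_maxr => //;
      exact: measurable_funN.
  by move=> z; rewrite lee_fin le_max lexx orbT.
Qed.

Variables (m1 : {sigma_finite_measure set T1 -> \bar R})
  (m2 : {sigma_finite_measure set T2 -> \bar R}).

Variables (f : T1 * T2 -> R) (p : T1 -> R) (q : T2 -> R).
Hypothesis mf : measurable_fun [set: T1 * T2] f.
Hypothesis ip : m1.-integrable [set: T1] (EFin \o p).
Hypothesis iq : m2.-integrable [set: T2] (EFin \o q).
Hypothesis fpq : forall x y, `|f (x, y)| <= p x * q y.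

Lemma integrable_prod_dominated :
  (m1 \x m2)%E.-integrable [set: T1 * T2] (EFin \o f).
Proof.
have mp := integrable_measurable ip; have mq := integrable_measurable iq.
apply/(integrable12ltyP _ _ _).2; first exact/measurable_EFinP.
have mpq : measurable_fun [set: T1 * T2] (fun z => `|p z.1| * `|q z.2|).
  by apply: measurable_funM; apply: measurableT_comp => //;
    apply: measurableT_comp.
have mEf : measurable_fun [set: T1 * T2] (fun z => `|f z|%:E).
  by apply/measurable_EFinP; exact: measurableT_comp.
apply: (@le_lt_trans _ _ (\int[m1]_x ((\int[m2]_y `|q y|%:E) * `|p x|%:E))%E).
  apply: ge0_le_integral => //.
  - by move=> x _; exact: integral_ge0.
  - exact: (measurable_fun_fubini_tonelli_F (m2 := m2) (fun z => `|f z|%:E)).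
  - apply: emeasurable_funM => //.
    by apply/measurable_EFinP; exact: measurableT_comp.
  - move=> x _; rewrite -ge0_integralZr//; last first.
      by apply/measurable_EFinP; exact: measurableT_comp.
    apply: ge0_le_integral => //.
    + apply/measurable_EFinP; apply: measurableT_comp => //.
      by apply: measurableT_comp => //; exact: pair1_measurable.
    + apply/measurable_EFinP; apply: measurable_funM => //;
      exact: measurableT_comp.
    + move=> y _; rewrite -EFinM lee_fin mulrC; apply: le_trans (fpq x y) _.
      by rewrite -normrM ler_norm.
rewrite ge0_integralZl//; last 2 first.
- by apply/measurable_EFinP; exact: measurableT_comp.
- by apply: integral_ge0.
move/integrableP : ip => [_ ip']; move/integrableP : iq => [_ iq'].
by rewrite lte_mul_pinfty// ?integral_ge0// ge0_fin_numE// integral_ge0.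
Qed.

(** Because the bound p(x) q(y) holds everywhere, this is true for every x and not only almost every
    x; so Fubini's theorem passes to [Rintegral] without exceptional sets. *)
Lemma integrable_section1 (x : T1) : m2.-integrable [set: T2] (fun y => (f (x,
  y))%:E).
Proof.
apply: (le_integrable measurableT _ _ (integrableZl measurableT (p x) iq)).
- by apply/measurable_EFinP; apply: measurableT_comp => //;
  exact: pair1_measurable.
- by move=> y _ /=; rewrite lee_fin; apply: le_trans (fpq x y) (ler_norm _).
Qed.

Lemma integrable_section2 (y : T2) : m1.-integrable [set: T1] (fun x => (f (x,
  y))%:E).
Proof.
apply: (le_integrable measurableT _ _ (integrableZr measurableT (q y) ip)).
- by apply/measurable_EFinP; apply: measurableT_comp => //;
  exact: pair2_measurable.
- by move=> x _ /=; rewrite lee_fin; apply: le_trans (fpq x y) (ler_norm _).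
Qed.

Lemma Rintegral_prod1 :
  \int[(m1 \x m2)%E]_z f z = \int[m1]_x \int[m2]_y f (x, y).
Proof.
rewrite {1}/Rintegral -integral12_prod_meas1;
  last exact: integrable_prod_dominated.
congr fine; apply: eq_integral => x _; rewrite /fubini_F/= fineK//.
exact: integrable_fin_num (integrable_section1 x).
Qed.

Lemma Rintegral_prod2 :
  \int[(m1 \x m2)%E]_z f z = \int[m2]_y \int[m1]_x f (x, y).
Proof.
rewrite {1}/Rintegral -integral21_prod_meas1;
  last exact: integrable_prod_dominated.
congr fine; apply: eq_integral => y _; rewrite /fubini_G/= fineK//.
exact: integrable_fin_num (integrable_section2 y).
Qed.

Lemma Rintegral_fubini :
  \int[m1]_x \int[m2]_y f (x, y) = \int[m2]_y \int[m1]_x f (x, y).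
Proof. by rewrite -Rintegral_prod1 Rintegral_prod2. Qed.

End fubini.

(** * Primitives of kernels *)

Section primitive.
Context (R : realType).
Local Notation mu := (@lebesgue_measure R).

(** With the half-line moved into the integrand, the latter becomes jointly measurable in u and v,
    as Fubini requires. *)
Lemma KbarE (k : R -> R) (u : R) :
  Kbar k u = \int[mu]_v (if v <= u then k v else 0).
Proof.
rewrite /Kbar Rintegral_mkcond; apply: eq_Rintegral => v _.
by rewrite patchE; congr (if _ then _ else _); rewrite mem_setE in_itv/=.
Qed.

Lemma measurable_if_le d (T : measurableType d) (k u v : T -> R) :
  measurable_fun [set: T] k -> measurable_fun [set: T] u ->
  measurable_fun [set: T] v ->
  measurable_fun [set: T] (fun t => if v t <= u t then k t else 0).
Proof. by move=> mk mu_ mv; apply: measurable_fun_ifT => //;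
  exact: measurable_fun_ler. Qed.

Lemma measurable_Kbar (k : R -> R) :
  measurable_fun [set: R] k -> measurable_fun [set: R] (Kbar k).
Proof.
move=> mk; rewrite (_ : Kbar k = fun u => \int[mu]_v (if v <=
  u then k v else 0)).
  apply: (measurable_Rintegral_param mu
    (f := fun z : measurableTypeR R * measurableTypeR R => if z.2 <=
      z.1 then k z.2 else 0)).
  by apply: measurable_if_le => //; exact: measurableT_comp.
by apply/funext => u; rewrite KbarE.
Qed.

Section integrable_kernel.
Variable k : R -> R.
Hypothesis ik : mu.-integrable [set: R] (EFin \o k).

Let mk : measurable_fun [set: R] k := integrable_measurable ik.

Lemma integrable_if_le (u : R) :
  mu.-integrable [set: R] (EFin \o (fun v => if v <= u then k v else 0)).
Proof.
apply: (le_integrable measurableT _ _ ik) => //.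
  by apply/measurable_EFinP; apply: measurable_if_le.
by move=> v _ /=; case: ifP => // _; rewrite normr0 lee_fin.
Qed.

Lemma normr_Kbar_le (u : R) : `|Kbar k u| <= \int[mu]_v `|k v|.
Proof.
rewrite KbarE; apply: le_trans (le_normr_Rintegral measurableT
  (integrable_if_le u)) _.
apply: le_Rintegral => //; [exact: integrable_norm (integrable_if_le u)|exact:
  integrable_norm|].
by move=> v _; case: ifP => // _; rewrite normr0.
Qed.

Lemma Kbar_eq0 (u : R) : (forall v, k v != 0 -> `|v| <= 1) -> u < -1 ->
  Kbar k u = 0.
Proof.
move=> k1 u1; rewrite KbarE (@eq_Rintegral _ _ _ _ _ (fun=> 0));
  first by rewrite Rintegral_cst// mul0r.
move=> v _; case: ifP => // vu; apply/eqP/negPn/negP => /k1.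
by rewrite ler_norml => /andP[h _]; move: (lt_le_trans u1 h); rewrite ltNge vu.
Qed.

Lemma integrable_mul_Kbar :
  mu.-integrable [set: R] (EFin \o (fun v => k v * Kbar k v)).
Proof. exact: integrable_mul_bounded ik (measurable_Kbar mk) normr_Kbar_le. Qed.

(* Split the square {v <= u, w <= u} along its diagonal. *)
Lemma Kbar_sqr (u : R) : Kbar k u ^+ 2 = Kbar (fun v => 2 * Kbar k v * k v) u.
Proof.
pose ku v := if v <= u then k v else 0.
have iku : mu.-integrable [set: R] (EFin \o ku) := integrable_if_le u.
have mku := integrable_measurable iku.
pose f (z : measurableTypeR R * measurableTypeR R) :=
  ku z.1 * (if z.2 <= z.1 then ku z.2 else 0).
have mf : measurable_fun [set: measurableTypeR R * measurableTypeR R] f.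
  by apply: measurable_funM; [exact: measurableT_comp|apply: measurable_if_le
    => //; exact: measurableT_comp].
have fpq x y : `|f (x, y)| <= `|ku x| * `|ku y|.
  by rewrite /f/= normrM ler_wpM2l//; case: ifP => // _; rewrite normr0.
have ia := integrable_norm iku.
have inner v : \int[mu]_w f (v, w) = ku v * Kbar k v.
  rewrite /f/= KbarE -RintegralZl//; last exact: integrable_if_le.
  apply: eq_Rintegral => w _; rewrite /ku; case: ifP => vu;
    last by rewrite !mul0r.
  by case: ifP => // wv; rewrite (le_trans wv vu).
have diag v : \int[mu]_w (if w == v then ku w else 0) = 0.
  rewrite -[RHS](Rintegral_set1 ku v) [RHS]Rintegral_mkcond;
    apply: eq_Rintegral => w _.
  by rewrite patchE; congr (if _ then _ else _); apply/eqP/idP; rewrite inE.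
(* The half-line w >= v is everything minus w <= v plus the diagonal w = v, and the diagonal is a
   null set. *)
have inner2 v : \int[mu]_w f (w, v) = ku v * (Kbar k u - Kbar k v).
  rewrite /f/=; have [vu|uv] := leP v u; last first.
    rewrite /ku (leNgt v u) uv/= mul0r;
      rewrite (@eq_Rintegral _ _ _ _ _ (fun=> 0)) ?Rintegral_cst ?mul0r//.
    by move=> w _; case: ifP => _; case: ifP => _; rewrite ?mulr0 ?mul0r.
  have i1 : mu.-integrable [set: R] (EFin \o (fun w => if w <=
    v then ku w else 0)).
    apply: (le_integrable measurableT _ _ iku) => //.
      by apply/measurable_EFinP; apply: measurable_if_le.
    by move=> w _ /=; case: ifP => // _; rewrite normr0 lee_fin.
  have i2 : mu.-integrable [set: R] (EFin \o (fun w => if w == v then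
    ku w else 0)).
    apply: (le_integrable measurableT _ _ iku) => //.
      by apply/measurable_EFinP; apply: measurable_fun_ifT => //;
        exact: measurable_fun_eqr.
    by move=> w _ /=; case: ifP => // _; rewrite normr0 lee_fin.
  rewrite (KbarE _ v) -[in RHS]/(Kbar k u).
  have -> : \int[mu]_w (if w <= v then k w else 0) = \int[mu]_w (if w <=
    v then ku w else 0).
    by apply: eq_Rintegral => w _; rewrite /ku; case: ifP => // wv;
      rewrite (le_trans wv vu).
  have -> : Kbar k u - \int[mu]_w (if w <= v then ku w else 0) =
      \int[mu]_w (ku w - (if w <=
        v then ku w else 0) + (if w == v then ku w else 0)).
    rewrite RintegralD//; last exact: (integrableB measurableT iku i1).
    by rewrite diag addr0 RintegralB// KbarE.
  rewrite -RintegralZl//; last first.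
    exact: (integrableD measurableT (integrableB measurableT iku i1) i2).
  apply: eq_Rintegral => w _; rewrite mulrC; have [wv|vw|->] := ltgtP w v.
  - by ring.
  - by ring.
  - by ring.
have ikuK : mu.-integrable [set: R] (EFin \o (fun v => ku v * Kbar k v)).
  exact: integrable_mul_bounded iku (measurable_Kbar mk) normr_Kbar_le.
(* With I the integral of [ku v * Kbar k v], equating the two orders of integration reads I =
   Kbar(u)^2 - I. *)
have := Rintegral_fubini mf ia ia fpq.
under eq_Rintegral do rewrite inner.
under [X in _ = X]eq_Rintegral do rewrite inner2 mulrBr.
rewrite RintegralB//; last exact: (integrableZr measurableT _ iku).
rewrite RintegralZr// -KbarE => e.
have -> : Kbar (fun v => 2 * Kbar k v * k v) u =
  \int[mu]_v (2 * (ku v * Kbar k v)).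
  by rewrite KbarE; apply: eq_Rintegral => v _; rewrite /ku; case: ifP => _;
    ring.
by rewrite RintegralZl// expr2; move: e; rewrite -/ku; lra.
Qed.

Lemma integrable_2mul_Kbar :
  mu.-integrable [set: R] (EFin \o (fun v => 2 * Kbar k v * k v)).
Proof.
have := integrableZl measurableT 2 integrable_mul_Kbar.
by apply: eq_integrable => // v _ /=; rewrite -EFinM; congr EFin; ring.
Qed.

End integrable_kernel.
End primitive.

(** * Expectations *)

Section expectation_Kbar.
Context (R : realType) (d : measure_display) (T : measurableType d).
Variables (P : probability T R).
Local Notation mu := (@lebesgue_measure R).

Lemma bounded_integrable (g : T -> R) (C : R) :
  measurable_fun [set: T] g -> (forall w, `|g w| <= C) ->
  P.-integrable [set: T] (EFin \o g).
Proof.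
move=> mg gC; apply: measurable_bounded_integrable => //.
  by rewrite (le_lt_trans (probability_le1 P measurableT))// ltey.
by exists C; split; [exact: num_real|move=> t Ct x _;
  exact: le_trans (gC x) (ltW Ct)].
Qed.

Lemma Rintegral_prob_cst (c : R) : \int[P]_w c = c.
Proof. by rewrite Rintegral_cst// (congr1 fine (probability_setT P)) mulr1. Qed.

Lemma Rintegral_prob_if (A : set T) (c : R) : measurable A ->
  \int[P]_w (if w \in A then c else 0) = c * fine (P A).
Proof.
move=> mA; rewrite -Rintegral_cst// [RHS]Rintegral_mkcond.
by apply: eq_Rintegral => w _; rewrite patchE.
Qed.

Variables (Y : T -> R) (G : R -> R) (k : R -> R) (x h : R).
Hypothesis mY : measurable_fun [set: T] Y.
Hypothesis YG : forall t, P (Y @^-1` `]-oo, t]) = (G t)%:E.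
Hypothesis ik : mu.-integrable [set: R] (EFin \o k).
Hypothesis h0 : 0 < h.

Let mYt t : measurable (Y @^-1` `]-oo, t]).
Proof. by rewrite -[X in measurable X]setTI; exact: mY. Qed.

Lemma prob_le_ge0 t : 0 <= G t.
Proof. by rewrite -lee_fin -YG measure_ge0. Qed.

Lemma prob_le_le1 t : G t <= 1.
Proof. by rewrite -lee_fin -YG probability_le1. Qed.

Lemma prob_le_nondecreasing : {homo G : s t / s <= t}.
Proof.
move=> s t st; rewrite -lee_fin -!YG le_measure ?inE//.
by move=> w /=; rewrite !in_itv/= => /le_trans; apply.
Qed.

Lemma measurable_prob_le : measurable_fun [set: R] G.
Proof. exact: nondecreasing_measurable prob_le_nondecreasing. Qed.

Lemma measurable_Kbar_comp :
  measurable_fun [set: T] (fun w => Kbar k ((x - Y w) / h)).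
Proof.
apply: measurableT_comp; first exact: measurable_Kbar
  (integrable_measurable ik).
by apply: measurable_funM => //; exact: measurable_funB.
Qed.

(** After Fubini, the event v <= (x - Y) / h is Y <= x - h v. Only the distribution function of [Y]
    enters, so the formula also serves the reflected variable a + b - X. *)
Lemma expect_Kbar :
  \int[P]_w Kbar k ((x - Y w) / h) = \int[mu]_v (k v * G (x - h * v)).
Proof.
have mk := integrable_measurable ik.
under eq_Rintegral do rewrite KbarE.
pose f (z : T * measurableTypeR R) :=
  if z.2 <= (x - Y z.1) / h then k z.2 else 0.
have mf : measurable_fun [set: T * measurableTypeR R] f.
  apply: measurable_if_le => //; first exact: measurableT_comp.
  by apply: measurable_funM => //; apply: measurable_funB => //;
    exact: measurableT_comp.
have i1 : P.-integrable [set: T] (EFin \o cst (1 : R)).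
  by apply: (bounded_integrable (C := 1)) => // w; rewrite normr1.
have fpq w v : `|f (w, v)| <= cst 1 w * `|k v|.
  by rewrite mul1r /f/=; case: ifP => // _; rewrite normr0.
have := Rintegral_fubini mf i1 (integrable_norm ik) fpq; rewrite {1}/f/= => ->.
apply: eq_Rintegral => v _.
rewrite -[G _]/(fine (G _)%:E) -YG -Rintegral_prob_if//.
apply: eq_Rintegral => w _; rewrite /f/=; congr (if _ then _ else _).
apply/idP/idP; rewrite inE/= in_itv/= ler_pdivlMr//; lra.
Qed.

(** [Kbar k] vanishes below -1, that is when Y > x + h, and is bounded by the integral of |k|
    elsewhere. The factor G(x + h) is what makes second moments small near the left end. *)
Lemma expect_Kbar_sqr_le : (forall v, k v != 0 -> `|v| <= 1) ->
  \int[P]_w (Kbar k ((x - Y w) / h) ^+ 2) <=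
  (\int[mu]_v `|k v|) ^+ 2 * G (x + h).
Proof.
move=> k1; rewrite -[G _]/(fine (G _)%:E) -YG -Rintegral_prob_if//.
set D := \int[mu]_v _; have D0 : 0 <= D by apply: Rintegral_ge0.
have ub w : Kbar k ((x - Y w) / h) ^+ 2 <= D ^+ 2.
  have nK := normr_Kbar_le ik ((x - Y w) / h).
  by rewrite -[X in X <= _]real_normK ?num_real// ler_sqr ?nnegrE.
apply: le_Rintegral => //.
- apply: (bounded_integrable (C := D ^+ 2)).
    by apply: measurable_funX; exact: measurable_Kbar_comp.
  by move=> w; rewrite ger0_norm ?sqr_ge0.
- apply: (bounded_integrable (C := D ^+ 2)).
    exact/(measurable_restrictT (cst (D ^+ 2)) (mYt (x + h))).1.
  by move=> w; case: ifP => _; rewrite ?normr0 ?sqr_ge0// ger0_norm ?sqr_ge0.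
move=> w _; case: ifPn => // /negP; rewrite inE/= in_itv/= => /negP;
  rewrite -ltNge => xY.
rewrite Kbar_eq0 ?expr0n//; rewrite ltr_pdivrMr// mulN1r; lra.
Qed.

End expectation_Kbar.

(** * Mean and variance of averages of independent copies *)

Section iid.
Context (R : realType) (d : measure_display) (T : measurableType d).
Variables (P : probability T R) (X : nat -> {RV P >-> R}) (f : R -> R).
Hypothesis hindep : mutually_independent X.
Hypothesis hdens : forall i, is_density (X i) f.

Lemma measurable_comp_RV (Y : {RV P >-> R}) (g : R -> R) :
  measurable_fun [set: R] g -> measurable_fun [set: T] (fun w => g (Y w)).
Proof. by move=> mg; apply: measurableT_comp => //;
  exact: measurable_funPT Y. Qed.

Lemma Rintegral_distribution (Y : {RV P >-> R}) (g : R -> R) (C : R) :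
  measurable_fun [set: R] g -> (forall t, `|g t| <= C) ->
  \int[P]_w g (Y w) = \int[distribution P Y]_t g t.
Proof.
move=> mg gC; rewrite /Rintegral integral_distribution//;
  first exact/measurable_EFinP.
apply: (bounded_integrable _ (C := C)) => //; exact: measurableT_comp.
Qed.

Lemma Rintegral_identical (g : R -> R) (C : R) (i : nat) :
  measurable_fun [set: R] g -> (forall t, `|g t| <= C) ->
  \int[P]_w g (X i w) = \int[P]_w g (X 0%N w).
Proof.
move=> mg gC; rewrite !(@Rintegral_distribution _ _ C)//.
congr fine; apply: eq_measure_integral => A mA _.
have [_ _ ei] := hdens i; have [_ _ e0] := hdens 0%N.
exact: etrans (ei A mA) (esym (e0 A mA)).
Qed.

(** On rectangles the law of the pair is the product of the two laws, so the two measures coincide;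
    Fubini then factors the bounded integrand. *)
Lemma Rintegral_independent (g : R -> R) (C : R) (i j : nat) : i != j ->
  measurable_fun [set: R] g -> (forall t, `|g t| <= C) ->
  \int[P]_w (g (X i w) * g (X j w)) =
  (\int[P]_w g (X i w)) * (\int[P]_w g (X j w)).
Proof.
move=> ij mg gC.
have C0 : 0 <= C by exact: le_trans (gC 0).
have mXY : measurable_fun [set: T] (fun w => (X i w, X j w))
  by apply: measurable_fun_pair;
  [exact: (measurable_funPT (X i))|exact: (measurable_funPT (X j))].
pose XY : {mfun T >-> (R * R)%type} :=
  HB.pack (fun w => (X i w, X j w)) (isMeasurableFun.Build _ _ _ _ _ mXY).
pose f2 (z : R * R) := g z.1 * g z.2.
have mf2 : measurable_fun [set: R * R] f2.
  by apply: measurable_funM; exact: measurableT_comp.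
have f2C z : `|f2 z| <= C * C by rewrite normrM ler_pM.
have iC k : (distribution P (X k)).-integrable [set: R] (EFin \o cst C).
  by apply: (bounded_integrable _ (C := C)) => // w; rewrite ger0_norm.
have -> : \int[P]_w (g (X i w) * g (X j w)) = \int[distribution P XY]_z f2 z.
  rewrite /Rintegral integral_distribution//; first exact/measurable_EFinP.
  apply: (bounded_integrable P (C := C * C)) => //.
  by apply: measurable_funM; exact: measurable_comp_RV.
have -> : \int[distribution P XY]_z f2 z =
    \int[(distribution P (X i) \x distribution P (X j))%E]_z f2 z.
  congr fine. apply: eq_measure_integral => A mA _; apply/esym.
  apply: product_measure_unique => // B D mB mD.
  pose s := [:: i; j]; pose S k := if k == i then B else D.
  have := hindep (s := s) (A := S).
  rewrite big_cons big_seq1 /S eqxx eq_sym (negbTE ij) => <-.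
  - rewrite /distribution/= /pushforward; congr (P _); apply/seteqP;
    split => w /=.
      by move=> [Bi Dj] k /=; rewrite !inE => /orP[]/eqP->;
        rewrite ?eqxx // eq_sym (negbTE ij).
    move=> h; split; first by have := h i; rewrite /= !inE eqxx; apply.
    by have := h j; rewrite /= !inE eqxx orbT eq_sym (negbTE ij); apply.
  - by rewrite /= inE ij.
  - by move=> k _; case: ifP.
rewrite (Rintegral_prod1 mf2 (iC i) (iC j)); last
  by move=> x y; exact: f2C (x, y).
have ig k : (distribution P (X k)).-integrable [set: R] (EFin \o g).
  exact: bounded_integrable _ mg gC.
transitivity (\int[distribution P (X i)]_x (g x * \int[distribution P
  (X j)]_y g y)).
  by apply: eq_Rintegral => x _; exact: (RintegralZl (g x) measurableT (ig j)).
rewrite RintegralZr//; last exact: ig.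
by congr (_ * _); apply/esym; exact: (Rintegral_distribution _ mg gC).
Qed.

Lemma Rintegral_sum (I : Type) (r : seq I) (g : I -> T -> R) :
  (forall i, P.-integrable [set: T] (EFin \o g i)) ->
  P.-integrable [set: T] (EFin \o (fun w => \sum_(i <- r) g i w)) /\
  \int[P]_w (\sum_(i <- r) g i w) = \sum_(i <- r) \int[P]_w g i w.
Proof.
move=> ig; elim: r => [|i r [IH1 IH2]].
  under [X in EFin \o X]eq_fun do rewrite big_nil.
  split; first by apply: (bounded_integrable _ (C := 0)) => // w;
    rewrite normr0.
  by under eq_Rintegral do rewrite big_nil; rewrite Rintegral_prob_cst big_nil.
under [X in EFin \o X]eq_fun do rewrite big_cons.
split; first exact: (integrableD measurableT (ig i) IH1).
by under eq_Rintegral do rewrite big_cons; rewrite RintegralD// IH2 big_cons.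
Qed.

Section mean.
Variables (g : R -> R) (C : R) (n : nat).
Hypothesis mg : measurable_fun [set: R] g.
Hypothesis gC : forall t, `|g t| <= C.
Hypothesis n0 : (0 < n)%N.

Let Z w := n%:R^-1 * \sum_(i < n) g (X i w).

Let nR0 : n%:R != 0 :> R. Proof. by rewrite pnatr_eq0 -lt0n. Qed.

Let ig i : P.-integrable [set: T] (EFin \o (fun w => g (X i w))).
Proof. by apply: (bounded_integrable _ (C := C)) => //;
  exact: measurable_comp_RV. Qed.

Lemma expectation_mean : ('E_P[Z])%E = (\int[P]_w g (X 0%N w))%:E.
Proof.
have [iS eS] := Rintegral_sum (index_enum 'I_n) (fun i => ig i).
have iZ : P.-integrable [set: T] (EFin \o Z) :=
  integrableZl measurableT n%:R^-1 iS.
rewrite unlock -[LHS]fineK; last exact: integrable_fin_num.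
congr EFin; rewrite -/(Rintegral _ _ _) /Z RintegralZl// eS.
under eq_bigr do rewrite (@Rintegral_identical _ C)//.
by rewrite sumr_const card_ord -[X in _ * X]mulr_natl mulKf.
Qed.

(** After centring, only the n diagonal terms of the double sum survive: the others factor into
    products of zero means. *)
Lemma variance_mean : variance P Z =
  (((\int[P]_w (g (X 0%N w) ^+ 2)) - (\int[P]_w g (X 0%N w)) ^+ 2) / n%:R)%:E.
Proof.
set m := \int[P]_w g _.
pose th t := g t - m.
have thC t : `|th t| <= C + `|m|.
  by apply: le_trans (ler_normB _ _) _; rewrite lerD2r.
have mth : measurable_fun [set: R] th by exact: measurable_funB.
have C0 : 0 <= C + `|m| by exact: le_trans (thC 0).
rewrite /variance unlock expectation_mean/= -/m.
have Zm w : Z w - m = n%:R^-1 * \sum_(i < n) th (X i w).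
  by rewrite /th sumrB mulrBr sumr_const card_ord -[m *+ n]mulr_natl mulKf.
have -> : ((Z \- cst m) * (Z \- cst m))%R = fun w =>
    n%:R^-1 ^+ 2 * \sum_(i < n) \sum_(j < n) th (X i w) * th (X j w).
  apply/funext => w; rewrite !fctE/= Zm expr2 mulrACA; congr (_ * _).
  by rewrite mulr_suml; apply: eq_bigr => i _; rewrite mulr_sumr.
have ith (i j : nat) :
  P.-integrable [set: T] (EFin \o (fun w => th (X i w) * th (X j w))).
  apply: (bounded_integrable _ (C := (C + `|m|) * (C + `|m|))).
    by apply: measurable_funM; exact: measurable_comp_RV.
  by move=> w; rewrite normrM ler_pM.
have i1 (i : 'I_n) := Rintegral_sum (index_enum 'I_n) (fun j : 'I_n => ith i j).
have [i2 e2] := Rintegral_sum (index_enum 'I_n) (fun i : 'I_n => (i1 i).1).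
rewrite unlock -[LHS]fineK; last exact: integrable_fin_num (integrableZl
  measurableT (n%:R^-1 ^+ 2) i2).
congr EFin; rewrite -/(Rintegral _ _ _) RintegralZl// e2.
have mth0 (i : nat) : \int[P]_w th (X i w) = 0.
  rewrite (@Rintegral_identical _ (C + `|m|))// /th RintegralB//; last first.
    by apply: (bounded_integrable _ (C := `|m|)).
  by rewrite Rintegral_prob_cst subrr.
have sq0 : \int[P]_w (th (X 0%N w) * th (X 0%N w)) =
  \int[P]_w (g (X 0%N w) ^+ 2) - m ^+ 2.
  have ig2 : P.-integrable [set: T] (EFin \o (fun w => g (X 0%N w) ^+ 2)).
    apply: (bounded_integrable _ (C := C ^+ 2)).
      by apply: measurable_funX; exact: measurable_comp_RV.
    by move=> w; rewrite normrX lerXn2r ?nnegrE// (le_trans _ (gC 0)).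
  have igm : P.-integrable [set: T] (EFin \o (fun w => 2 * m * g (X 0%N w))) :=
    integrableZl measurableT (2 * m) (ig 0%N).
  have im : P.-integrable [set: T] (EFin \o (fun w => m ^+ 2)).
    by apply: (bounded_integrable _ (C := `|m ^+ 2|)).
  under eq_Rintegral => w _.
    rewrite (_ : _ * _ = g (X 0%N w) ^+ 2 - 2 * m * g (X 0%N w) + m ^+ 2);
      last by rewrite /th; ring.
    over.
  rewrite RintegralD//; last exact: (integrableB measurableT ig2 igm).
  by rewrite RintegralB// RintegralZl// Rintegral_prob_cst -/m; ring.
under eq_bigr => i _.
  rewrite (i1 i).2 (bigD1 i)//= big1; last first.
    move=> j ji; rewrite (@Rintegral_independent _ (C + `|m|))//;
      last by rewrite eq_sym.
    by rewrite mth0 mul0r.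
  rewrite addr0 (@Rintegral_identical (fun t => th t * th t) ((C + `|m|) * (C +
    `|m|)))//; last 2 first.
  - exact: measurable_funM.
  - by move=> t; rewrite normrM ler_pM.
  rewrite sq0.
  over.
rewrite sumr_const card_ord -[X in _ * X]mulr_natl; field.
exact: nR0.
Qed.

End mean.
End iid.

(** * Moments of the kernel *)

Section kernel_moments.
Context (R : realType).
Local Notation mu := (@lebesgue_measure R).

(** A nonnegative [phi] with integral 0 vanishes almost everywhere. The point 0 is excluded because
    [phi] carries a factor u or u^2 in the positivity proofs below, so that its vanishing says
    nothing there. *)
Lemma Rintegral_eq_of_null (p q phi : R -> R) :
  measurable_fun [set: R] p -> measurable_fun [set: R] q ->
  mu.-integrable [set: R] (EFin \o phi) -> (forall u, 0 <= phi u) ->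
  \int[mu]_u phi u = 0 ->
  (forall u, u != 0 -> phi u = 0 -> p u = q u) ->
  \int[mu]_u p u = \int[mu]_u q u.
Proof.
move=> mp mq iphi phi0 phiI pq.
congr fine; apply: ae_eq_integral => //;
  [exact/measurable_EFinP|exact/measurable_EFinP|].
have ae1 : ae_eq mu [set: R] (EFin \o phi) (cst 0%E).
  apply/ae_eq_integral_abs => //; first exact: measurable_int iphi.
  under eq_integral do rewrite /= ger0_norm//.
  by rewrite -[LHS]fineK ?(integrable_fin_num measurableT iphi)// -[X in
    X%:E]/(\int[mu]_u phi u) phiI.
have ae2 : {ae mu, forall u : R, u != 0}.
  exists [set 0]; split; [exact: measurable_set1|exact: lebesgue_measure_set1|].
  by move=> u /= /negP; rewrite negbK => /eqP.
apply: filterS2 ae1 ae2 => u /= h u0 _; congr EFin; apply: pq => //.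
by have [] := h I.
Qed.

Variable K : R -> R.
Hypothesis hK : is_kernel K.
Let K0 := kernel_ge0 hK.
Let mK : measurable_fun [set: R] K. Proof. by case: hK. Qed.

Lemma kernel_integrable : mu.-integrable [set: R] (EFin \o K).
Proof.
apply/integrableP; split; first exact/measurable_EFinP.
under eq_integral do rewrite /= ger0_norm//.
by rewrite (kernel_integral1 hK) ltry.
Qed.
Let iK := kernel_integrable.

Lemma kernel_Rintegral1 : \int[mu]_u K u = 1.
Proof. by rewrite /Rintegral (kernel_integral1 hK). Qed.

Lemma kernel_normr_le1 u : K u != 0 -> `|u| <= 1.
Proof.
move=> Ku; have : tsupport K u by exact: subset_closure.
by rewrite (kernel_support hK)/= in_itv/= ler_norml.
Qed.

Lemma kernel_abs_integral : \int[mu]_u `|K u| = 1.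
Proof. by under eq_Rintegral do rewrite ger0_norm//;
  exact: kernel_Rintegral1. Qed.

Lemma integrable_id_mul : mu.-integrable [set: R] (EFin \o (fun u => u * K u)).
Proof. exact: (integrable_moment 1 iK kernel_normr_le1). Qed.

Lemma kernel_mean0 : \int[mu]_u (u * K u) = 0.
Proof.
have := integral_affine (c := -1) 0 _ integrable_id_mul.
rewrite normrN1 mul1r oppr_eq0 oner_eq0 => /(_ isT) e.
suff : \int[mu]_u (u * K u) = - \int[mu]_u (u * K u) by lra.
rewrite {1}e -[RHS]mulN1r -RintegralZl//; last exact: integrable_id_mul.
by apply: eq_Rintegral => u _; rewrite addr0 !mulN1r (kernel_symmetric hK);
  ring.
Qed.

Lemma Kbar_ge0 u : 0 <= Kbar K u.
Proof. exact: Rintegral_ge0. Qed.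

Lemma Kbar_nondecreasing : {homo Kbar K : u v / u <= v}.
Proof.
move=> u v uv; rewrite !KbarE; apply: le_Rintegral => //;
  [exact: integrable_if_le|exact: integrable_if_le|].
move=> w _; case: ifP => wu; first by rewrite (le_trans wu uv).
by case: ifP.
Qed.

Lemma Kbar0 : Kbar K 0 = 1 / 2.
Proof.
have i0 := integrable_if_le iK 0.
have := integral_affine (c := -1) 0 _ i0.
rewrite normrN1 mul1r oppr_eq0 oner_eq0 => /(_ isT).
have i1 : mu.-integrable [set: R] (EFin \o (fun u => if 0 <=
  u then K u else 0)).
  apply: (le_integrable measurableT _ _ iK) => //.
    by apply/measurable_EFinP; apply: (measurable_if_le (v := cst 0)).
  by move=> v _ /=; case: ifP => // _; rewrite normr0 lee_fin.
have -> : \int[mu]_u (if -1 * u + 0 <= 0 then K (-1 * u + 0) else 0) =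
    \int[mu]_u (if 0 <= u then K u else 0).
  by apply: eq_Rintegral => u _; rewrite addr0 mulN1r
    (kernel_symmetric hK) oppr_le0.
move=> e.
have : \int[mu]_u (if u <= 0 then K u else 0) + \int[mu]_u (if 0 <=
  u then K u else 0) = 1.
  rewrite -kernel_Rintegral1 -RintegralD//.
  (* With [phi] = 0 the lemma merely discards the point 0, which both half-lines contain. *)
  apply: (@Rintegral_eq_of_null _ _ (cst 0)) => //.
  - by apply: measurable_funD; [exact: integrable_measurable i0|exact:
    integrable_measurable i1].
  - exact: integrable0.
  - by rewrite Rintegral_cst// mul0r.
  - by move=> u u0 _; case: ltgtP u0 => // _ _; rewrite ?add0r ?addr0.
by rewrite KbarE -e; lra.
Qed.

Lemma Bfun_ge0 u : 0 <= Bfun K u.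
Proof. by rewrite /Bfun !mulr_ge0// Kbar_ge0. Qed.

Lemma integrable_Bfun : mu.-integrable [set: R] (EFin \o Bfun K).
Proof. exact: integrable_2mul_Kbar. Qed.

Lemma Bfun_normr_le1 u : Bfun K u != 0 -> `|u| <= 1.
Proof. by rewrite /Bfun mulf_eq0 negb_or => /andP[_ /kernel_normr_le1]. Qed.

Lemma Kbar_eq_integral (k : R -> R) : (forall u, k u != 0 -> `|u| <= 1) ->
  Kbar k 1 = \int[mu]_u k u.
Proof.
move=> k1; rewrite KbarE; apply: eq_Rintegral => u _; case: ifPn => //.
rewrite -ltNge => u1; apply/esym/eqP/negPn/negP => /k1.
by rewrite ler_norml => /andP[_]; rewrite leNgt u1.
Qed.

Lemma Bfun_Rintegral1 : \int[mu]_u Bfun K u = 1.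
Proof.
rewrite -(Kbar_eq_integral Bfun_normr_le1) -[Kbar _ _](Kbar_sqr iK).
by rewrite (Kbar_eq_integral kernel_normr_le1) kernel_Rintegral1 expr1n.
Qed.

Lemma Bfun_abs_integral : \int[mu]_u `|Bfun K u| = 1.
Proof. by under eq_Rintegral do rewrite ger0_norm ?Bfun_ge0//;
  exact: Bfun_Rintegral1. Qed.

(* Otherwise B = K almost everywhere, since u (B(u) - K(u)) >= 0, and then
   Kbar^2 = Kbar at 0, where Kbar = 1 / 2. *)
Lemma kernel_kappa_gt0 : 0 < \int[mu]_u (u * Bfun K u).
Proof.
have iuB := integrable_moment 1 integrable_Bfun Bfun_normr_le1.
(* As K has mean 0, subtracting u K leaves the integral unchanged; the result u (2 Kbar - 1) K is
   nonnegative because Kbar - 1 / 2 has the sign of u. *)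
pose phi u := u * Bfun K u - u * K u.
have iphi : mu.-integrable [set: R] (EFin \o phi) :=
  integrableB measurableT iuB integrable_id_mul.
have phi0 u : 0 <= phi u.
  rewrite /phi /Bfun (_ : _ - _ = (u * (2 * Kbar K u - 1)) * K u); last by ring.
  apply: mulr_ge0 => //; have [u0|/ltW u0] := leP 0 u.
    by have := Kbar_nondecreasing u0; rewrite Kbar0 => ?;
      apply: mulr_ge0 => //; lra.
  by have := Kbar_nondecreasing u0; rewrite Kbar0 => ?; apply: mulr_le0 => //;
    lra.
have phiE : \int[mu]_u phi u = \int[mu]_u (u * Bfun K u).
  by rewrite RintegralB//; [rewrite kernel_mean0 subr0|exact:
    integrable_id_mul].
rewrite -phiE lt_neqAle Rintegral_ge0// andbT; apply/eqP => /esym phiI.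
have : Kbar (Bfun K) 0 = Kbar K 0.
  rewrite !KbarE; apply: Rintegral_eq_of_null phiI _ => //.
  - exact: integrable_measurable (integrable_if_le integrable_Bfun 0).
  - exact: integrable_measurable (integrable_if_le iK 0).
  - move=> u u0 /eqP; rewrite /phi -mulrBr mulf_eq0 (negbTE u0)/=
    subr_eq0 => /eqP ->//.
rewrite -[Kbar (Bfun K) 0](Kbar_sqr iK) Kbar0; lra.
Qed.

Lemma kernel_mu2_gt0 : 0 < \int[mu]_u (u ^+ 2 * K u).
Proof.
have i2 := integrable_moment 2 iK kernel_normr_le1.
have phi0 u : 0 <= u ^+ 2 * K u by rewrite mulr_ge0// sqr_ge0.
rewrite lt_neqAle Rintegral_ge0// andbT; apply/eqP => /esym phiI.
have := kernel_Rintegral1; rewrite (Rintegral_eq_of_null (q :=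
  cst 0) mK _ i2 phi0 phiI)//.
  by rewrite Rintegral_cst// mul0r; lra.
by move=> u u0 /eqP; rewrite mulf_eq0 expf_eq0 (negbTE u0)/= => /eqP.
Qed.

Lemma kernel_mu2_le1 : \int[mu]_u (u ^+ 2 * K u) <= 1.
Proof.
rewrite -kernel_Rintegral1; apply: le_Rintegral => //.
  exact: integrable_moment 2 iK kernel_normr_le1.
move=> u _; have [->|/kernel_normr_le1 u1] := eqVneq (K u) 0;
  first by rewrite mulr0.
by rewrite ler_piMl// -real_normK ?num_real// exprn_ile1.
Qed.

End kernel_moments.

(** * Pointwise expansions *)

Section cdf_density.
Context (R : realType) (d : measure_display) (T : measurableType d).
Variables (P : probability T R) (Y : {RV P >-> R}) (f F : R -> R) (a b : R).
Hypothesis hdens : is_density Y f.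
Hypothesis hsupp : tsupport f = `[a, b]%classic.
Hypothesis hF : forall x, cdf Y x = (F x)%:E.
Local Notation mu := (@lebesgue_measure R).

Let f0 x : ~ `[a, b]%classic x -> f x = 0.
Proof.
move=> xab; apply/eqP/negPn/negP => fx; apply: xab.
by rewrite -hsupp; exact: subset_closure.
Qed.

Let mf : measurable_fun [set: R] f. Proof. by case: hdens. Qed.

Let PY (A : set R) : measurable A ->
  P (Y @^-1` A) = (\int[mu]_(x in A) (f x)%:E)%E.
Proof. by move=> mA; have [_ _ /(_ A mA) <-] := hdens. Qed.

Let PY0 (A : set R) : measurable A -> (forall x, A x ->
  ~ `[a, b]%classic x) -> P (Y @^-1` A) = 0.
Proof.
move=> mA Aab; rewrite PY// (eq_integral (cst 0%E)) ?integral0//.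
by move=> x /[!inE] /Aab/f0 ->.
Qed.

Lemma cdf_preimage t : P (Y @^-1` `]-oo, t]) = (F t)%:E.
Proof. by rewrite -hF. Qed.

(** A law with a density has no atoms. Reflection turns Y <= t into Y >= c - t, whose complement is
    a strict inequality; the strict form is also what gives F(a) = 0. *)
Lemma prob_lt t : P (Y @^-1` `]-oo, t[) = (F t)%:E.
Proof.
rewrite -cdf_preimage !PY// integral_itv_bndo_bndc//.
by apply/measurable_EFinP; exact: measurable_funTS.
Qed.

Lemma cdf_left t : t <= a -> F t = 0.
Proof.
move=> ta; apply: EFin_inj; rewrite -prob_lt PY0// => x.
by rewrite /= !in_itv/= => xt /andP[ax _]; move: (lt_le_trans xt ta);
  rewrite ltNge ax.
Qed.

Lemma cdf_right t : b <= t -> F t = 1.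
Proof.
move=> bt; apply: EFin_inj; rewrite -cdf_preimage -[X in P X]setCK.
rewrite probability_setC; last first.
  by apply: measurableC; rewrite -[X in measurable X]setTI;
    exact: measurable_funPT.
rewrite preimage_setC setCitvl PY0 ?sube0// => x.
by rewrite /= !in_itv/= andbT => tx /andP[_ xb]; move: (le_lt_trans bt tx);
  rewrite ltNge xb.
Qed.

Lemma reflected_preimage (c t : R) :
  P ((fun w => c - Y w) @^-1` `]-oo, t]) = (1 - F (c - t))%:E.
Proof.
rewrite EFinB -prob_lt -probability_setC; last first.
  by rewrite -[X in measurable X]setTI; exact: measurable_funPT.
congr (P _); apply/seteqP; split => w /=; rewrite !in_itv/=.
  by move=> h; apply/negP; rewrite -leNgt; lra.
by move/negP; rewrite -leNgt; lra.
Qed.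

End cdf_density.

Section boundary.
Context (R : realType) (d : measure_display) (T : measurableType d).
Variables (P : probability T R) (Y : T -> R) (G g : R -> R) (k : R -> R).
Variables (a b x h M L : R).
Local Notation mu := (@lebesgue_measure R).
Local Notation al := ((x - a) / h).
Hypothesis mY : measurable_fun [set: T] Y.
Hypothesis YG : forall t, P (Y @^-1` `]-oo, t]) = (G t)%:E.
Hypothesis Ga : G a = 0.
Hypothesis M0 : 0 <= M.
Hypothesis taylorG : forall s t, s \in `[a, b] -> t \in `[a, b] ->
  `|G t - G s - (t - s) * g s| <= M * ((t - s) ^+ 2 / 2).
Hypothesis lipG : forall t, t \in `[a, b] -> G t <= L * (t - a).
Hypothesis h0 : 0 < h <= (b - a) / 2.
Hypothesis xh : a < x < a + h.
Hypothesis ik : mu.-integrable [set: R] (EFin \o k).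
Hypothesis k1 : tsupport k `<=` `[-1, al].
Hypothesis kmu : al * (1 - \int[mu]_u k u) + \int[mu]_u (u * k u) = 0.

Let D := \int[mu]_u `|k u|.

Let al01 : 0 < al < 1.
Proof.
case/andP: h0 => h0' _; case/andP: xh => ax xah.
by rewrite divr_gt0 ?subr_gt0//= ltr_pdivrMr// mul1r ltrBlDl.
Qed.

Let kal u : k u != 0 -> -1 <= u <= al.
Proof.
move=> ku; have /k1 : tsupport k u by exact: subset_closure.
by rewrite /= in_itv.
Qed.

Let k1' u : k u != 0 -> `|u| <= 1.
Proof.
by move=> /kal/andP[u1 ua]; case/andP: al01 => _ a1;
  rewrite ler_norml u1 (le_trans ua (ltW a1)).
Qed.

(** Stated for an abstract [G] with [G a = 0], so that it serves both F and 1 - F(a + b - t). On the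
    support of [k], u <= alpha keeps x - h u above a, while u >= -1 and h <= (b - a) / 2 keep it
    below b; hence Taylor's formula on [a, b] applies under the integral. *)
Lemma boundary_bias :
  `|\int[P]_w Kbar k ((x - Y w) / h) - G x| <= M * h ^+ 2 * (1 + D).
Proof.
case/andP: h0 => hp hab; case/andP: (xh) => ax xah.
have D0 : 0 <= D by exact: Rintegral_ge0.
have xab : x \in `[a, b] by rewrite in_itv/=; apply/andP; split; lra.
have aab : a \in `[a, b] by rewrite in_itv/=; apply/andP; split; lra.
have alh : al * h = x - a by rewrite divfK// lt0r_neq0.
rewrite (expect_Kbar _ mY YG ik hp).
have taylor_u u : k u != 0 ->
    `|G (x - h * u) - G x + h * u * g x - (h * u) ^+ 2 / 2 * 0| <=
      M * ((h * u) ^+ 2 / 2).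
  move=> /kal/andP[u1 ua].
  have hua : h * u <= x - a by rewrite -alh mulrC ler_pM2r.
  have hu1 : - h <= h * u by rewrite -mulrN1 ler_pM2l.
  have tab : x - h * u \in `[a, b] by rewrite in_itv/=; apply/andP; split; lra.
  have := taylorG xab tab.
  have -> : x - h * u - x = - (h * u) by ring.
  by rewrite sqrrN mulr0 subr0 mulNr opprK.
have := weighted_taylor ik k1' (measurable_prob_le mY YG) _ M0 taylor_u.
have Gle t : `|G t| <= 1 by rewrite ger0_norm ?(prob_le_ge0 YG)//;
  exact: (prob_le_le1 mY YG).
move=> /(_ Gle); rewrite mulr0 mul0r addr0 -/D.
set I := \int[mu]_v _; set m0 := \int[mu]_u k u; set m1 := \int[mu]_u _ => hI.
have m0D : `|m0| <= D by exact: le_normr_Rintegral.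
have em1 : m1 = - (al * (1 - m0)) by move: kmu; rewrite -/m0 -/m1; lra.
have Gx : `|G x - (x - a) * g x| <= M * h ^+ 2 / 2.
  have := taylorG xab aab; rewrite Ga sub0r -normrN.
  have -> : - (- G x - (a - x) * g x) = G x - (x - a) * g x by ring.
  move/le_trans; apply; rewrite -mulrA ler_wpM2l// ler_wpM2r ?invr_ge0//.
  by rewrite -sqrrN opprB lerXn2r ?nnegrE; lra.
have -> : I - G x = (I - (G x * m0 - h * g x * m1)) - (1 - m0) * (G x -
  (x - a) * g x).
  by rewrite em1; field; rewrite lt0r_neq0.
apply: le_trans (ler_normB _ _) _; rewrite normrM.
have h1 : `|1 - m0| <= 1 + D
  by apply: le_trans (ler_normB _ _) _; rewrite normr1 lerD2l.
have h2 : `|1 - m0| * `|G x - (x - a) * g x| <= (1 + D) * (M * h ^+ 2 / 2)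
  by rewrite ler_pM.
have Mh : 0 <= M * h ^+ 2 by rewrite mulr_ge0// sqr_ge0.
apply: le_trans (lerD hI h2) _; nra.
Qed.

(** The square costs at most D^2 G(x + h), and in the left zone G(x + h) <= L (x + h - a) <= 2 L
    h. *)
Lemma boundary_sqr : \int[P]_w (Kbar k ((x - Y w) / h) ^+ 2) <=
  2 * L * h * D ^+ 2.
Proof.
case/andP: h0 => hp hab; case/andP: (xh) => ax xah.
apply: le_trans (expect_Kbar_sqr_le _ mY YG ik hp k1') _.
have xab : x + h \in `[a, b] by rewrite in_itv/=; apply/andP; split; lra.
have L0 : 0 <= L.
  have := le_trans (prob_le_ge0 YG _) (lipG xab); rewrite pmulr_lge0//; lra.
rewrite mulrC -/D ler_wpM2r ?sqr_ge0//; apply: le_trans (lipG xab) _.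
have : L * (x + h - a) <= L * (2 * h) by rewrite ler_wpM2l//; lra.
by move/le_trans; apply; lra.
Qed.

End boundary.

Section interior.
Context (R : realType) (d : measure_display) (T : measurableType d).
Variables (P : probability T R) (Y : T -> R) (G : R -> R) (K : R -> R).
Variables (x h g1 c e : R).
Local Notation mu := (@lebesgue_measure R).
Hypothesis mY : measurable_fun [set: T] Y.
Hypothesis YG : forall t, P (Y @^-1` `]-oo, t]) = (G t)%:E.
Hypothesis hK : is_kernel K.
Hypothesis h0 : 0 < h.
Hypothesis e0 : 0 <= e.
Hypothesis taylorG : forall u, `|u| <= 1 ->
  `|G (x - h * u) - G x + h * u * g1 - (h * u) ^+ 2 / 2 * c| <=
    e * ((h * u) ^+ 2 / 2).

Let G1 t : `|G t| <= 1.
Proof. by rewrite ger0_norm ?(prob_le_ge0 YG)//;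
  exact: (prob_le_le1 mY YG). Qed.

Let mG := measurable_prob_le mY YG.

Lemma interior_bias :
  `|\int[P]_w Kbar K ((x - Y w) / h) - G x -
    h ^+ 2 / 2 * c * (\int[mu]_u (u ^+ 2 * K u))| <= e * h ^+ 2 / 2.
Proof.
have iK := kernel_integrable hK; rewrite (expect_Kbar _ mY YG iK h0).
have := weighted_taylor iK (kernel_normr_le1 hK) mG G1 e0
  (fun u Ku => taylorG (kernel_normr_le1 hK Ku)).
rewrite (kernel_Rintegral1 hK) (kernel_mean0 hK) (kernel_abs_integral hK).
by rewrite !mulr1 mulr0 subr0 opprD addrA.
Qed.

(** Unlike K, the density B has a nonzero mean, and this leaves the term of order h. Since c = 0, e
    stands here for a bound on the second derivative. *)
Lemma interior_sqr : c = 0 ->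
  `|\int[P]_w (Kbar K ((x - Y w) / h) ^+ 2) -
    (G x - h * g1 * (\int[mu]_u (u * Bfun K u)))| <= e * h ^+ 2 / 2.
Proof.
move=> c0; have iB := integrable_Bfun hK.
under eq_Rintegral do rewrite (Kbar_sqr (kernel_integrable hK)).
rewrite -[X in Kbar X]/(Bfun K) (expect_Kbar _ mY YG iB h0).
have := weighted_taylor iB (Bfun_normr_le1 hK) mG G1 e0
  (fun u Bu => taylorG (Bfun_normr_le1 hK Bu)).
rewrite (Bfun_Rintegral1 hK) (Bfun_abs_integral hK) c0.
by rewrite !mulr1 mulr0 mul0r addr0.
Qed.

End interior.

(** * Bias and variance of the estimator, at a point and integrated *)

Section pointwise.
Context (R : realType) (d : measure_display) (T : measurableType d).
Variables (P : probability T R) (X : nat -> {RV P >-> R}) (f F : R -> R)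
  (a b : R) (K : R -> R) (KL : R -> R -> R).
Hypothesis hab : a < b.
Hypothesis hindep : mutually_independent X.
Hypothesis hdens : forall i, is_density (X i) f.
Hypothesis hsupp : tsupport f = `[a, b]%classic.
Hypothesis hF : forall i x, cdf (X i) x = (F x)%:E.
Hypothesis hK : is_kernel K.
Hypothesis hKL : is_boundary_kernel KL.
Hypothesis hmu : forall al : R, 0 < al < 1 ->
  al * (1 - muL KL 0 al) + muL KL 1 al = 0.
Variables g1 g2 : R -> R.
Hypothesis dF : forall t, t \in `[a, b] -> is_derive_in `[a, b] F t (g1 t).
Hypothesis dg1 : forall t, t \in `[a, b] -> is_derive_in `[a, b] g1 t (g2 t).
Variable M : R.
Hypothesis M0 : 0 < M.
Hypothesis g2M : forall t, t \in `[a, b] -> `|g2 t| <= M.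
Local Notation mu := (@lebesgue_measure R).
(** A slope bound at both ends: adding the two end derivatives lets one constant control F near a
    and 1 - F near b. *)
Local Notation L := (`|g1 a| + `|g1 b| + M * (b - a)).

Lemma taylor_bound s t : s \in `[a, b] -> t \in `[a, b] ->
  `|F t - F s - (t - s) * g1 s| <= M * ((t - s) ^+ 2 / 2).
Proof.
move=> sab tab; have [z [zab _ ->]] := taylor_lagrange dF dg1 sab tab.
rewrite (_ : _ - _ - _ = (t - s) ^+ 2 / 2 * g2 z); last by ring.
by rewrite normrM mulrC ler_pM ?g2M// ger0_norm// divr_ge0// sqr_ge0.
Qed.

(** The error carries the oscillation e of [g2] instead of its size M; this is how the interior bias
    gets an error of smaller order than h^2. *)
Lemma taylor_modulus e r s t : s \in `[a, b] -> t \in `[a, b] ->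
  (forall y z, y \in `[a, b] -> z \in `[a, b] -> `|z - y| < r ->
    `|g2 z - g2 y| <= e) ->
  `|t - s| < r ->
  `|F t - F s - (t - s) * g1 s - (t - s) ^+ 2 / 2 * g2 s| <=
    e * ((t - s) ^+ 2 / 2).
Proof.
move=> sab tab uc ts; have [z [zab zs ->]] := taylor_lagrange dF dg1 sab tab.
rewrite (_ : _ - _ - _ - _ = (t - s) ^+ 2 / 2 * (g2 z - g2 s)); last by ring.
rewrite normrM mulrC ler_pM// ?uc//; first exact: le_lt_trans zs ts.
by rewrite ger0_norm// divr_ge0// sqr_ge0.
Qed.

Let Fa : F a = 0. Proof. exact: (cdf_left (hdens 0%N) hsupp (hF 0%N)). Qed.
Let Fb : F b = 1. Proof. exact: (cdf_right (hdens 0%N) hsupp (hF 0%N)). Qed.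

Lemma cdf_lip_left t : t \in `[a, b] -> F t <= L * (t - a).
Proof.
move=> /[dup] tab; rewrite in_itv/= => /andP[at_ tb].
have aab : a \in `[a, b] by rewrite in_itv/= lexx ltW.
have := taylor_bound aab tab; rewrite Fa subr0 => /ler_normlP[_].
have h1 : (t - a) * g1 a <= (t - a) * `|g1 a|
  by rewrite ler_wpM2l ?subr_ge0// ler_norm.
have h2 : 0 <= (t - a) * `|g1 b| by rewrite mulr_ge0 ?subr_ge0.
have h3 : M * ((t - a) ^+ 2 / 2) <= (t - a) * (M * (b - a)).
  have : (t - a) * ((t - a) / 2) <= (t - a) * (b - a)
    by rewrite ler_wpM2l ?subr_ge0//; lra.
  by move=> ?; rewrite [leRHS]mulrCA ler_wpM2l ?(ltW M0)// expr2 -mulrA.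
lra.
Qed.

Local Notation Fr := (fun t => 1 - F (a + b - t)).

Lemma cdf_lip_right t : t \in `[a, b] -> Fr t <= L * (t - a).
Proof.
rewrite in_itv/= => /andP[at_ tb].
have bab : b \in `[a, b] by rewrite in_itv/= lexx ltW.
have tab : a + b - t \in `[a, b] by rewrite in_itv/=; apply/andP; split; lra.
have := taylor_bound bab tab; rewrite Fb => /ler_normlP[+ _].
have -> : a + b - t - b = - (t - a) by ring.
rewrite sqrrN.
have h1 : (t - a) * g1 b <= (t - a) * `|g1 b|
  by rewrite ler_wpM2l ?subr_ge0// ler_norm.
have h2 : 0 <= (t - a) * `|g1 a| by rewrite mulr_ge0 ?subr_ge0.
have h3 : M * ((t - a) ^+ 2 / 2) <= (t - a) * (M * (b - a)).
  have : (t - a) * ((t - a) / 2) <= (t - a) * (b - a)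
    by rewrite ler_wpM2l ?subr_ge0//; lra.
  by move=> ?; rewrite [leRHS]mulrCA ler_wpM2l ?(ltW M0)// expr2 -mulrA.
lra.
Qed.

Variable h : R.
Hypothesis h0 : 0 < h <= (b - a) / 2.

Let hp : 0 < h. Proof. by case/andP: h0. Qed.
Let hab2 : 2 * h <= b - a. Proof. by case/andP: h0; lra. Qed.

Definition local_kernel (x y : R) : R := Kbar_loc K KL a b h x ((x - y) / h).

Lemma local_kernelL x y : a < x < a + h ->
  local_kernel x y = Kbar (KL^~ ((x - a) / h)) ((x - y) / h).
Proof. by case/andP=> ax xh; rewrite /local_kernel /Kbar_loc xh. Qed.

Lemma local_kernelM x y : a + h <= x <= b - h ->
  local_kernel x y = Kbar K ((x - y) / h).
Proof. by case/andP=> ax xh; rewrite /local_kernel /Kbar_loc ltNge ax/= xh. Qed.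

Let al01 x : a < x < a + h -> 0 < (x - a) / h < 1.
Proof. by case/andP=> ax xh; rewrite divr_gt0 ?subr_gt0//= ltr_pdivrMr//
  mul1r ltrBlDl. Qed.

Let alr01 x : b - h < x < b -> 0 < (b - x) / h < 1.
Proof. by case/andP=> ax xh; rewrite divr_gt0 ?subr_gt0//= ltr_pdivrMr//
  mul1r; lra. Qed.

Lemma boundary_kernel_integrable al : 0 < al < 1 ->
  mu.-integrable [set: R] (EFin \o KL^~ al).
Proof. by move=> /hKL[]. Qed.

(** The substitution v -> -v turns the upper tail of [KR] into the primitive of [KL] at -(x - y) /
    h, the argument that belongs to the reflected point and observation. This reduces the right zone
    to the left one. *)
Lemma local_kernelR x y : b - h < x < b ->
  local_kernel x y = 1 - Kbar (KL^~ ((b - x) / h)) (((a + b - x) - (a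
    + b - y)) / h).
Proof.
move=> /[dup] /alr01 al /andP[xh xb]; rewrite /local_kernel /Kbar_loc.
rewrite ltNge (_ : a + h <= x)/=; last by have := hab2; lra.
rewrite leNgt xh/= /KbarR; congr (1 - _).
have ik := boundary_kernel_integrable al.
set k := KL^~ _ in ik *; rewrite KbarE.
have := integral_affine (c :=
  -1) 0 _ (integrable_if_le ik ((a + b - x - (a + b - y)) / h)).
rewrite normrN1 mul1r oppr_eq0 oner_eq0 => /(_ isT) ->.
rewrite Rintegral_mkcond; apply: eq_Rintegral => v _.
rewrite patchE addr0 mulN1r /KR -/(k (- v)); congr (if _ then _ else _).
rewrite mem_setE in_itv/= andbT lerNl -mulNr; congr (_ / _ <= _); ring.
Qed.

(** The sum of the bounds for the three zones. It may be unbounded in x: its use is integrability in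
    w at fixed x. *)
Definition local_bound (x : R) : R :=
  1 + \int[mu]_u `|K u| + `|absmu0 KL ((x - a) / h)| + `|absmu0 KL
    ((b - x) / h)|.

Lemma local_kernel_bounded x y : a < x < b ->
  `|local_kernel x y| <= local_bound x.
Proof.
case/andP => ax xb; rewrite /local_bound (kernel_abs_integral hK).
have n1 := normr_ge0 (absmu0 KL ((x - a) / h));
  have n2 := normr_ge0 (absmu0 KL ((b - x) / h)).
have [xh|xh] := ltP x (a + h).
  have xx : a < x < a + h by rewrite ax.
  rewrite local_kernelL//; apply: le_trans (normr_Kbar_le
    (boundary_kernel_integrable (al01 xx)) _) _.
  by rewrite -/(absmu0 _ _); have := ler_norm (absmu0 KL ((x - a) / h)); lra.
have [xh'|xh'] := leP x (b - h).
  rewrite local_kernelM ?xh ?xh'//;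
    apply: le_trans (normr_Kbar_le (kernel_integrable hK) _) _.
  by rewrite (kernel_abs_integral hK); lra.
have xx : b - h < x < b by rewrite xb andbT.
rewrite local_kernelR//; apply: le_trans (ler_normB _ _) _; rewrite normr1.
have := normr_Kbar_le (boundary_kernel_integrable (alr01 xx)) ((a + b - x - (a
  + b - y)) / h).
by rewrite -/(absmu0 _ _); have := ler_norm (absmu0 KL ((b - x) / h)); lra.
Qed.

Lemma measurable_local_kernel x : a < x < b ->
  measurable_fun [set: R] (local_kernel x).
Proof.
have mK k (p : R -> R) : mu.-integrable [set: R] (EFin \o k) ->
  measurable_fun [set: R] p ->
    measurable_fun [set: R] (fun y => Kbar k (p y / h)).
  move=> ik mp; apply: measurableT_comp;
    first exact: measurable_Kbar (integrable_measurable ik).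
  exact: measurable_funM.
case/andP => ax xb.
have [xh|xh] := ltP x (a + h).
  have xx : a < x < a + h by rewrite ax.
  rewrite (funext (fun y => local_kernelL y xx)).
  by apply: mK; [exact: boundary_kernel_integrable (al01 xx)|exact:
    measurable_funB].
have [xh'|xh'] := leP x (b - h).
  have xx : a + h <= x <= b - h by rewrite xh.
  rewrite (funext (fun y => local_kernelM y xx)).
  by apply: mK; [exact: kernel_integrable|exact: measurable_funB].
have xx : b - h < x < b by rewrite xb andbT.
rewrite (funext (fun y => local_kernelR y xx)).
apply: measurable_funB => //; apply: mK;
  first exact: boundary_kernel_integrable (alr01 xx).
by apply: measurable_funB => //; exact: measurable_funB.
Qed.

Definition local_mean (x : R) : R := \int[P]_w local_kernel x (X 0%N w).
Definition local_sqr (x : R) : R := \int[P]_w (local_kernel x (X 0%N w) ^+ 2).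

Lemma estimator_in (n : nat) x w : a < x < b ->
  estimator K KL a b X n h x w = n%:R^-1 * \sum_(i < n) local_kernel x (X i w).
Proof. by case/andP => ax xb; rewrite /estimator leNgt ax/= leNgt xb. Qed.

Lemma estimator_out (n : nat) x w : ~~ (a < x < b) ->
  estimator K KL a b X n h x w = F x.
Proof.
rewrite negb_and -!leNgt /estimator => /orP[xa|bx].
  by rewrite xa (cdf_left (hdens 0%N) hsupp (hF 0%N)).
rewrite (cdf_right (hdens 0%N) hsupp (hF 0%N))// bx.
by rewrite leNgt (lt_le_trans hab bx).
Qed.

Lemma estimator_expectation (n : nat) x : (0 < n)%N ->
  ('E_P[estimator K KL a b X n h x])%E = (if a < x <
    b then local_mean x else F x)%:E.
Proof.
move=> n0; case: ifPn => xab.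
  rewrite -(expectation_mean hdens (measurable_local_kernel xab) (fun y =>
    local_kernel_bounded y xab) n0).
  by congr expectation; apply/funext => w; exact: estimator_in.
rewrite -[RHS](expectation_cst P).
by congr expectation; apply/funext => w; exact: estimator_out.
Qed.

Lemma estimator_variance (n : nat) x : (0 < n)%N ->
  variance P (estimator K KL a b X n h x) =
  (if a < x < b then (local_sqr x - local_mean x ^+ 2) / n%:R else 0)%:E.
Proof.
move=> n0; case: ifPn => xab.
  rewrite -(variance_mean hindep hdens (measurable_local_kernel xab) (fun y =>
    local_kernel_bounded y xab) n0).
  by congr (variance P _); apply/funext => w; exact: estimator_in.
rewrite -[RHS](variance_cst P (F x)).
by congr (variance P _); apply/funext => w; exact: estimator_out.
Qed.

Lemma kmuE al : 0 < al < 1 ->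
  al * (1 - \int[mu]_u KL u al) + \int[mu]_u (u * KL u al) = 0.
Proof.
move=> /hmu <-; congr (_ * (1 - _) + _).
by apply: eq_Rintegral => u _; rewrite expr0 mul1r.
Qed.

Let mX0 : measurable_fun [set: T] (X 0%N). Proof. exact: measurable_funPT. Qed.
Let X0F t : P (X 0%N @^-1` `]-oo, t]) =
  (F t)%:E. Proof. exact: cdf_preimage (hF 0%N) t. Qed.

Let Y0 w := a + b - X 0%N w.
Let mY0 : measurable_fun [set: T] Y0. Proof. exact: measurable_funB. Qed.
Let Y0F t : P (Y0 @^-1` `]-oo, t]) = (Fr t)%:E.
Proof. exact: (reflected_preimage (hdens 0%N) (hF 0%N)). Qed.

Let taylorFr s t : s \in `[a, b] -> t \in `[a, b] ->
  `|Fr t - Fr s - (t - s) * g1 (a + b - s)| <= M * ((t - s) ^+ 2 / 2).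
Proof.
rewrite !in_itv/= => /andP[s1 s2] /andP[t1 t2].
have sab : a + b - s \in `[a, b] by rewrite in_itv/=; apply/andP; split; lra.
have tab : a + b - t \in `[a, b] by rewrite in_itv/=; apply/andP; split; lra.
have := taylor_bound sab tab; rewrite -normrN.
have -> : a + b - t - (a + b - s) = - (t - s) by ring.
by rewrite sqrrN; congr (`|_| <= _); ring.
Qed.

Let Fra : Fr a = 0. Proof. by rewrite /= (_ : a + b - a = b) ?Fb ?subrr//;
  ring. Qed.

Lemma left_bias x : a < x < a + h ->
  `|local_mean x - F x| <= M * h ^+ 2 * (1 + absmu0 KL ((x - a) / h)).
Proof.
move=> xx; have al := al01 xx; have [supp ik] := hKL al.
rewrite /local_mean; under eq_Rintegral do rewrite local_kernelL//.
exact: (boundary_bias mX0 X0F Fa (ltW M0) taylor_bound h0 xx ik supp (kmuE al)).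
Qed.

Lemma left_sqr x : a < x < a + h ->
  local_sqr x <= 2 * L * h * absmu0 KL ((x - a) / h) ^+ 2.
Proof.
move=> xx; have al := al01 xx; have [supp ik] := hKL al.
rewrite /local_sqr; under eq_Rintegral do rewrite local_kernelL//.
exact: (boundary_sqr mX0 X0F cdf_lip_left h0 xx ik supp).
Qed.

Let xr x : b - h < x < b -> a < a + b - x < a + h.
Proof. by move=> /andP[h1 h2]; apply/andP; split; lra. Qed.

Let suba x : b - x = a + b - x - a. Proof. by ring. Qed.

Let local_kernelR' x y : b - h < x < b ->
  local_kernel x y = 1 - Kbar (KL^~ ((a + b - x - a) / h)) ((a + b - x - (a
    + b - y)) / h).
Proof. by move=> xx; rewrite local_kernelR// suba. Qed.

Let integrable_Kr x : b - h < x < b -> P.-integrable [set: T]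
  (EFin \o (fun w => Kbar (KL^~ ((a + b - x - a) / h)) ((a + b - x
    - Y0 w) / h))).
Proof.
move=> /[dup] xx /xr/al01 al; have [_ ik] := hKL al.
apply: (bounded_integrable _ (measurable_Kbar_comp _ _ mY0 ik)) => w.
exact: normr_Kbar_le ik _.
Qed.

Let local_meanR x : b - h < x < b -> local_mean x =
  1 - \int[P]_w Kbar (KL^~ ((a + b - x - a) / h)) ((a + b - x - Y0 w) / h).
Proof.
move=> xx; rewrite /local_mean; under eq_Rintegral do rewrite local_kernelR'//.
rewrite RintegralB//; first by rewrite Rintegral_prob_cst.
- by apply: (bounded_integrable _ (C := 1)) => // w; rewrite normr1.
- exact: integrable_Kr xx.
Qed.

Lemma right_bias x : b - h < x < b ->
  `|local_mean x - F x| <= M * h ^+ 2 * (1 + absmu0 KL ((b - x) / h)).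
Proof.
move=> xx; have al := al01 (xr xx); have [supp ik] := hKL al.
have := boundary_bias mY0 Y0F Fra (ltW M0) taylorFr h0 (xr xx) ik
  supp (kmuE al).
rewrite local_meanR// -normrN -suba (_ : a + b - (a + b - x) = x); last by ring.
by congr (`|_| <= _); ring.
Qed.

(** Near b the summand is 1 - [ph], whose second moment is not small. Hence the bound is on the
    variance, which is that of [ph] and so at most the second moment of [ph]. *)
Lemma right_sqr x : b - h < x < b ->
  local_sqr x - local_mean x ^+ 2 <= 2 * L * h * absmu0 KL ((b - x) / h) ^+ 2.
Proof.
move=> xx; have al := al01 (xr xx); have [supp ik] := hKL al.
have ib := integrable_Kr xx.
have := boundary_sqr mY0 Y0F cdf_lip_right h0 (xr xx) ik supp;
  rewrite -/(absmu0 _ _).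
rewrite local_meanR// /local_sqr -suba in ib *; set k := KL^~ _ in ib *.
set ph := fun w => Kbar k ((a + b - x - Y0 w) / h) in ib *.
have ib2 : P.-integrable [set: T] (EFin \o (fun w => ph w ^+ 2)).
  apply: (bounded_integrable _ (C := (\int[mu]_u `|k u|) ^+ 2)).
    by apply: measurable_funX; exact: integrable_measurable ib.
  move=> w; rewrite normrX lerXn2r ?nnegrE ?Rintegral_ge0//.
  by rewrite /ph normr_Kbar_le// /k suba.
have -> : \int[P]_w (local_kernel x (X 0%N w) ^+ 2) =
  1 - 2 * (\int[P]_w ph w) + \int[P]_w (ph w ^+ 2).
  have i1 : P.-integrable [set: T] (EFin \o (fun=> 1)).
    by apply: (bounded_integrable _ (C := 1)) => // w; rewrite normr1.
  have i2 : P.-integrable [set: T] (EFin \o (fun w => 2 * ph w)) :=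
    integrableZl measurableT 2 ib.
  rewrite -[X in X - _](Rintegral_prob_cst P 1) -RintegralZl// -RintegralB//
    -RintegralD//; last first.
    exact: (integrableB measurableT i1 i2).
  by apply: eq_Rintegral => w _; rewrite local_kernelR// /ph -/k; ring.
set m := \int[P]_w ph w; have : 0 <= m ^+ 2 by exact: sqr_ge0.
lra.
Qed.

Let inM x u : a + h <= x <= b - h -> `|u| <= 1 ->
  x \in `[a, b] /\ x - h * u \in `[a, b].
Proof.
move=> /andP[h1 h2]; rewrite ler_norml => /andP[u1 u2].
have hu1 : h * u <= h by rewrite ger_pMr.
have hu2 : - h <= h * u by rewrite -mulrN1 ler_pM2l.
by have := hp; rewrite !in_itv/=; split; apply/andP; split; lra.
Qed.

Let interior_taylor x u : a + h <= x <= b - h -> `|u| <= 1 ->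
  `|F (x - h * u) - F x + h * u * g1 x - (h * u) ^+ 2 / 2 * 0| <=
    M * ((h * u) ^+ 2 / 2).
Proof.
move=> xM u1; have [xab xuab] := inM xM u1.
have := taylor_bound xab xuab; rewrite (_ : x - h * u - x = - (h * u)); last
  by ring.
by rewrite sqrrN mulr0 subr0 mulNr opprK.
Qed.

Lemma local_bias x e r : a + h <= x <= b - h -> 0 <= e -> h < r ->
  (forall y z, y \in `[a, b] -> z \in `[a, b] -> `|z - y| < r ->
    `|g2 z - g2 y| <= e) ->
  `|local_mean x - F x - h ^+ 2 / 2 * g2 x * (\int[mu]_u (u ^+ 2 * K u))| <=
    e * h ^+ 2 / 2.
Proof.
move=> xM e0 hr uc; rewrite /local_mean;
  under eq_Rintegral do rewrite local_kernelM//.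
apply: (interior_bias (g1 := g1 x) mX0 X0F hK hp e0) => u u1.
have [xab xuab] := inM xM u1.
have := taylor_modulus xab xuab uc; rewrite (_ : x - h * u - x = - (h * u));
  last by ring.
rewrite sqrrN mulNr opprK normrN; apply.
by rewrite normrM gtr0_norm// (le_lt_trans _ hr)// ger_pMr.
Qed.

(** Writing m for the mean, m^2 - F^2 = (m - F) (m + F) with m and F in [0, 1]. The bias is O(h^2),
    so the term of order h comes from the second moment alone. *)
Lemma local_variance x : a + h <= x <= b - h ->
  `|local_sqr x - local_mean x ^+ 2 -
    (F x * (1 - F x) - h * g1 x * (\int[mu]_u (u * Bfun K u)))| <=
      2 * M * h ^+ 2.
Proof.
move=> xM.
have hm : `|local_mean x - F x| <= M * h ^+ 2 / 2.
  rewrite /local_mean; under eq_Rintegral do rewrite local_kernelM//.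
  have := interior_bias mX0 X0F hK hp (ltW M0) (fun u => interior_taylor xM).
  by rewrite mulr0 mul0r subr0.
have hs : `|local_sqr x - (F x - h * g1 x * (\int[mu]_u (u * Bfun K u)))| <=
  M * h ^+ 2 / 2.
  rewrite /local_sqr; under eq_Rintegral do rewrite local_kernelM//.
  exact: (interior_sqr mX0 X0F hK hp (ltW M0) (fun u => interior_taylor xM)).
have F01 : 0 <= F x <= 1 by rewrite (prob_le_ge0 X0F) (prob_le_le1 mX0 X0F).
have m01 : 0 <= local_mean x <= 1.
  rewrite /local_mean; under eq_Rintegral do rewrite local_kernelM//.
  have b01 w : 0 <= Kbar K ((x - X 0%N w) / h) <= 1.
    rewrite Kbar_ge0//= -(kernel_abs_integral hK).
    exact: le_trans (ler_norm _) (normr_Kbar_le (kernel_integrable hK) _).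
  rewrite Rintegral_ge0/=; last by move=> w _; case/andP: (b01 w).
  rewrite -[leRHS](Rintegral_prob_cst P); apply: le_Rintegral => //.
  - apply: (bounded_integrable _ (C := 1)).
      exact: (measurable_Kbar_comp x h mX0 (kernel_integrable hK)).
    by move=> w; case/andP: (b01 w) => ? ?; rewrite ger0_norm.
  - by apply: (bounded_integrable _ (C := 1)) => // w; rewrite normr1.
  - by move=> w _; case/andP: (b01 w).
set q := \int[mu]_u _ in hs *; set m := local_mean x in hm m01 *.
set s := local_sqr x in hs *.
have -> : s - m ^+ 2 - (F x * (1 - F x) - h * g1 x * q) =
  (s - (F x - h * g1 x * q)) - (m - F x) * (m + F x) by ring.
apply: le_trans (ler_normB _ _) _; rewrite normrM.
have h1 : `|m + F x| <= 2 by rewrite ger0_norm; lra.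
have h2 : `|m - F x| * `|m + F x| <= M * h ^+ 2 / 2 * 2 by rewrite ler_pM.
have : 0 <= M * h ^+ 2 by rewrite mulr_ge0 ?sqr_ge0// ltW.
lra.
Qed.

Hypothesis cg2 : {within `[a, b], continuous g2}.
Hypothesis hmu0 : mu.-integrable `]0, 1[ (fun al => (absmu0 KL al ^+ 2)%:E).

Let left_in x : a < x < a + h -> a < x < b.
Proof. by have := hab2; have := hp => ? ? /andP[? ?]; apply/andP; split;
  lra. Qed.

Let right_in x : b - h < x < b -> a < x < b.
Proof. by have := hab2; have := hp => ? ? /andP[? ?]; apply/andP; split;
  lra. Qed.

Let mid_in x : a + h <= x <= b - h -> a < x < b.
Proof. by have := hp => ? /andP[? ?]; apply/andP; split; lra. Qed.

Let in_closed x : a < x < b -> x \in `[a, b].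
Proof. by case/andP => ax xb; rewrite in_itv/= !ltW. Qed.

Let reflect_closed x : a < x < b -> a + b - x \in `[a, b].
Proof. by case/andP => ax xb; rewrite in_itv/=; apply/andP; split; lra. Qed.

(** With D = [absmu0 KL al], this dominates 1, D^2 and half of (1 + D)^2, the shapes of all the
    boundary bounds; it is integrable because D is square integrable. *)
Let rho al := 1 + absmu0 KL al ^+ 2.
Let W := \int[mu]_(al in `]0, 1[) rho al.
Let bw := boundary_weight a b h rho.
Let mid : set R := `[a + h, b - h]%classic.

Let rho0 al : 0 <= rho al. Proof. by rewrite addr_ge0// sqr_ge0. Qed.

Let irho : mu.-integrable `]0, 1[ (EFin \o rho).
Proof.
have m01 : measurable (`]0, 1[%classic : set (measurableTypeR R))
  by exact: measurable_itv.
have i1 : mu.-integrable `]0, 1[ (EFin \o cst 1).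
  apply: measurable_bounded_integrable => //.
    by rewrite /= lebesgue_measure_itv/= lte_fin ltr01 -EFinD ltry.
  by exists 1; split; [exact: num_real|move=> t t1 x _; rewrite /= normr1 ltW].
exact: (integrableD m01 i1 hmu0).
Qed.

Let ibw : mu.-integrable [set: R] (EFin \o bw).
Proof. exact: integrable_boundary_weight. Qed.

Let bw0 x : 0 <= bw x. Proof. exact: boundary_weight_ge0. Qed.

Let Ibw : \int[mu]_x bw x =
  2 * h * W. Proof. exact: Rintegral_boundary_weight. Qed.

Let bwl x : a < x < a + h -> 1 + absmu0 KL ((x - a) / h) ^+ 2 <= bw x.
Proof. exact: boundary_weight_left. Qed.

Let bwr x : b - h < x < b -> 1 + absmu0 KL ((b - x) / h) ^+ 2 <= bw x.
Proof. exact: boundary_weight_right. Qed.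

Lemma boundary_total_ge0 : 0 <= W. Proof. exact: Rintegral_ge0. Qed.

Let L0 : 0 <= L.
Proof. by rewrite !addr_ge0// mulr_ge0 ?(ltW M0)//; have := hab; lra. Qed.

Let submid : mid `<=` (`[a, b]%classic : set R).
Proof. by apply: subset_itvScc; rewrite bnd_simp; have := hp; lra. Qed.

Let imid (g : R -> R) : {within `[a, b], continuous g} ->
  mu.-integrable mid (EFin \o g).
Proof.
move=> cg; apply: continuous_compact_integrable; first exact: segment_compact.
exact: continuous_subspaceW submid cg.
Qed.

Let cF : {within `[a, b], continuous F} := C2_continuous0 dF.
Let cg1 : {within `[a, b], continuous g1} := C2_continuous1 dg1.

Let iFF : mu.-integrable mid (EFin \o (fun x => F x * (1 - F x))).
Proof.
apply: imid => x; apply: cvgM; first exact: cF.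
by apply: cvgB; [exact: cvg_cst|exact: cF].
Qed.

Let F01 x : 0 <= F x <= 1.
Proof. by rewrite (prob_le_ge0 X0F) (prob_le_le1 mX0 X0F). Qed.

(** In each zone one of F and 1 - F is at most L h, the other at most 1, and the weight is at least
    1; inside, there is no error at all (E = 0). *)
Lemma integral_cdf_variance :
  `|\int[mu]_x (F x * (1 - F x)) - \int[mu]_(x in mid) (F x * (1 - F x))| <=
    L * h * (2 * h * W).
Proof.
have := @integral_interior_boundary R a b h (L * h) 0 (fun x => (F x *
  (1 - F x))%:E)
  (fun x => F x * (1 - F x)) bw h0 iFF ibw bw0.
rewrite mul0r add0r Ibw => /(_ _ (lexx _)) H.
have FL x : a < x < a + h -> F x <= L * h.
  move=> xx; have xab := in_closed (left_in xx); case/andP: xx => ax xh.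
  by apply: le_trans (cdf_lip_left xab) _; rewrite ler_wpM2l//; lra.
have FR x : b - h < x < b -> 1 - F x <= L * h.
  move=> xx; have xab := reflect_closed (right_in xx); case/andP: xx => xh xb.
  have := cdf_lip_right xab; rewrite (_ : a + b - (a + b - x) = x); last
    by ring.
  by move/le_trans; apply; rewrite ler_wpM2l//; lra.
have Lh : 0 <= L * h by rewrite mulr_ge0// ltW.
apply: (H _ _ _ _ _ _).2 => //.
- by move=> x; have /andP[? ?] := F01 x; rewrite lee_fin mulr_ge0// subr_ge0.
- move=> x; rewrite negb_and -!leNgt => /orP[xa|bx].
    by rewrite (cdf_left (hdens 0%N) hsupp (hF 0%N) xa) mul0r.
  by rewrite (cdf_right (hdens 0%N) hsupp (hF 0%N) bx) subrr mulr0.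
- by move=> x _; rewrite subr0 addr0 lexx.
- move=> x xx; have /andP[? ?] := F01 x; rewrite lee_fin.
  apply: (@le_trans _ _ (L * h * 1)); last first.
    by rewrite ler_wpM2l//; apply: le_trans (bwl xx); rewrite lerDl sqr_ge0.
  by rewrite ler_pM ?subr_ge0 ?FL// lerBlDr lerDl.
- move=> x xx; have /andP[? ?] := F01 x; rewrite lee_fin.
  apply: (@le_trans _ _ (L * h * 1)); last first.
    by rewrite ler_wpM2l//; apply: le_trans (bwr xx); rewrite lerDl sqr_ge0.
  by rewrite mulr1 mulrC -[leRHS]mulr1 ler_pM ?subr_ge0 ?FR.
Qed.

(** Origin of the constants: 2 M (b - a) is the interior error; 6 L W is 4 L W from the variance in
    the two zones plus 2 L W from extending the integral of F (1 - F) to the whole line; 2 L kappa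
    comes from replacing F(b - h) - F(a + h) by 1. *)
Lemma Vint_expansion (n : nat) : (0 < n)%N ->
  Vint K KL a b X n h \is a fin_num /\
  `|fine (Vint K KL a b X n h) - Vlead K F n h| <=
    n%:R^-1 * h ^+ 2 *
    (2 * M * (b - a) + 6 * L * W + 2 * L * (\int[mu]_u (u * Bfun K u))).
Proof.
move=> n0; have nV : 0 <= n%:R^-1 :> R by rewrite invr_ge0.
set kap := \int[mu]_u _.
have kap0 : 0 < kap := kernel_kappa_gt0 hK.
pose phi x := n%:R^-1 * (F x * (1 - F x) - h * kap * g1 x).
have ig1 : mu.-integrable mid (EFin \o g1) := imid cg1.
have mmid : measurable (mid : set (measurableTypeR R)) by exact: measurable_itv.
have ig1' : mu.-integrable mid (EFin \o (fun x => h * kap * g1 x)) :=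
  integrableZl mmid (h * kap) ig1.
have iphi0 := integrableB mmid iFF ig1'.
have iphi : mu.-integrable mid (EFin \o phi) := integrableZl mmid n%:R^-1 iphi0.
have cc0 : 0 <= 2 * L * h / n%:R by rewrite !mulr_ge0// ltW.
have E0 : 0 <= 2 * M * h ^+ 2 / n%:R by rewrite !mulr_ge0 ?sqr_ge0// ltW.
have [vfin vbd] : Vint K KL a b X n h \is a fin_num /\
    `|fine (Vint K KL a b X n h) - \int[mu]_(x in mid) phi x| <=
    2 * M * h ^+ 2 / n%:R * (b - a) + 2 * L * h / n%:R * \int[mu]_x bw x.
  apply: (integral_interior_boundary h0 iphi ibw bw0 cc0 E0).
  - by move=> x; exact: variance_ge0.
  - by move=> x xab; rewrite estimator_variance// (negbTE xab).
  - move=> x xm; rewrite estimator_variance// ifT; last exact: mid_in.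
    have := local_variance xm; rewrite -/kap ler_distl => /andP[l1 l2].
    rewrite !lee_fin /phi ![_ / n%:R]mulrC -mulrBr -mulrDr !ler_wpM2l//; lra.
  - move=> x xx; rewrite estimator_variance// ifT; last exact: left_in.
    rewrite lee_fin mulrAC ler_wpM2r//.
    have := left_sqr xx; have := bwl xx; set D := absmu0 _ _ => hb hs.
    apply: (@le_trans _ _ (2 * L * h * D ^+ 2)).
      by apply: le_trans hs; rewrite lerBlDr lerDl sqr_ge0.
    rewrite ler_wpM2l ?mulr_ge0 ?(ltW hp)//; apply: le_trans hb;
      rewrite lerDr//.
  - move=> x xx; rewrite estimator_variance// ifT; last exact: right_in.
    rewrite lee_fin mulrAC ler_wpM2r//.
    have := right_sqr xx; have := bwr xx; set D := absmu0 _ _ => hb hs.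
    apply: le_trans hs _.
    rewrite ler_wpM2l ?mulr_ge0 ?(ltW hp)//; apply: le_trans hb;
      rewrite lerDr//.
rewrite Ibw in vbd; split=> //.
have ephi : \int[mu]_(x in mid) phi x =
    n%:R^-1 * (\int[mu]_(x in mid) (F x * (1 - F x)) - h * kap * (F (b - h)
      - F (a + h))).
  rewrite /phi RintegralZl// RintegralB// RintegralZl//;
    congr (_ * (_ - _ * _)).
  by apply: (Rintegral_derivative_itv dF dg1); have := hp; have := hab2; lra.
have hFF := integral_cdf_variance.
have mF1 : 0 <= F (a + h) <= L * h.
  rewrite (prob_le_ge0 X0F)/=; have := @cdf_lip_left (a + h);
    rewrite (_ : a + h - a = h); last by ring.
  apply.
  by have := hab2; have := hp => ? ?; rewrite in_itv/=; apply/andP; split; lra.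
have mF2 : 0 <= 1 - F (b - h) <= L * h.
  rewrite subr_ge0 (prob_le_le1 mX0 X0F)/=.
  have := @cdf_lip_right (a + h); rewrite (_ : a + b - (a + h) = b - h);
    last by ring.
  rewrite (_ : a + h - a = h); last by ring.
  apply.
  by have := hab2; have := hp => ? ?; rewrite in_itv/=; apply/andP; split; lra.
rewrite /Vlead -/kap; move: vbd hFF; rewrite ephi.
set V := fine _; set A := \int[mu]_(x in mid) _;
  set A' := \int[mu]_x (F x * _) => vbd hFF.
(* Uses F(b - h) - F(a + h) = 1 - (F(a + h) + (1 - F(b - h))), whose subtracted term is at most 2 L
   h. *)
have -> : V - (n%:R^-1 * A' - h / n%:R * kap) =
   (V - n%:R^-1 * (A - h * kap * (F (b - h) - F (a + h)))) - n%:R^-1 * (A' - A)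
   + n%:R^-1 * (h * kap * (F (a + h) + (1 - F (b - h)))) by ring.
have t2 : `|n%:R^-1 * (A' - A)| <= n%:R^-1 * (L * h * (2 * h * W)).
  by rewrite normrM ger0_norm// ler_wpM2l.
have t3 : `|n%:R^-1 * (h * kap * (F (a + h) + (1 - F (b - h))))| <=
  n%:R^-1 * (h * kap * (2 * L * h)).
  have hk : 0 <= h * kap by rewrite mulr_ge0// ltW.
  case/andP: mF1 => ? ?; case/andP: mF2 => ? ?.
  rewrite ger0_norm; last by rewrite mulr_ge0// mulr_ge0// addr_ge0.
  by rewrite ler_wpM2l// ler_wpM2l//; lra.
apply: le_trans (ler_normD _ _) _; apply: le_trans (lerD (ler_normB _ _) t3) _.
apply: le_trans (lerD (lerD vbd t2) (lexx _)) _.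
by rewrite le_eqVlt; apply/orP; left; apply/eqP; field; rewrite pnatr_eq0 -lt0n.
Qed.

(** The term e (M + e) bounds be^2 - q^2 = (be - q) ((be - q) + 2 q), with be the bias and q its
    leading part. Of the constant 10, the boundary zones use 4 and the extension of the integral of
    the squared second derivative to ]a, b[ uses 2. The modulus (e, r) stays free, to be chosen once
    a tolerance is given. *)
Lemma Bint_expansion (n : nat) (e r : R) : (0 < n)%N -> 0 <= e -> h < r ->
  (forall y z, y \in `[a, b] -> z \in `[a, b] -> `|z - y| < r ->
    `|g2 z - g2 y| <= e) ->
  Bint K KL a b X F n h \is a fin_num /\
  `|fine (Bint K KL a b X F n h) - Blead K F h| <=
    h ^+ 4 * (e * (M + e) * (b - a) + 10 * M ^+ 2 * W * h).
Proof.
move=> n0 e0 hr uc.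
set mu2 := \int[mu]_u (u ^+ 2 * K u).
have mu2_01 : 0 <= mu2 <= 1 by rewrite (ltW (kernel_mu2_gt0 hK)) kernel_mu2_le1.
have cg22 : {within `[a, b], continuous (fun x => g2 x ^+ 2)}.
  rewrite (_ : (fun x => g2 x ^+ 2) = (fun x => g2 x * g2 x)); last
    by apply/funext => x; rewrite expr2.
  by move=> x; apply: cvgM; exact: cg2.
have mmid : measurable (mid : set (measurableTypeR R)) by exact: measurable_itv.
have ig22 := imid cg22.
pose phi x := (h ^+ 2 / 2 * mu2) ^+ 2 * g2 x ^+ 2.
have iphi : mu.-integrable mid (EFin \o phi) :=
  integrableZl mmid ((h ^+ 2 / 2 * mu2) ^+ 2) ig22.
have h4 : 0 <= h ^+ 4 by rewrite exprn_ge0// ltW.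
have cc0 : 0 <= 2 * M ^+ 2 * h ^+ 4 by rewrite mulr_ge0// mulr_ge0 ?sqr_ge0.
have E0 : 0 <= h ^+ 4 * (e * (M + e))
  by rewrite mulr_ge0// mulr_ge0// addr_ge0// ltW.
have BE x : (('E_P[estimator K KL a b X n h x] - (F x)%:E) ^+ 2)%E =
    (if a < x < b then (local_mean x - F x) ^+ 2 else 0)%:E.
  rewrite estimator_expectation// -EFinD -EFin_expe; case: ifP => //.
  by rewrite subrr expr0n.
have bias_sqr x (D : R) : 0 <= D ->
  `|local_mean x - F x| <= M * h ^+ 2 * (1 + D) ->
    (local_mean x - F x) ^+ 2 <= 2 * M ^+ 2 * h ^+ 4 * (1 + D ^+ 2).
  move=> D0 hb; rewrite -real_normK ?num_real//.
  apply: (@le_trans _ _ ((M * h ^+ 2 * (1 + D)) ^+ 2)).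
    rewrite lerXn2r ?nnegrE// !mulr_ge0 ?sqr_ge0// ?addr_ge0// ltW//.
  have -> : (M * h ^+ 2 * (1 + D)) ^+ 2 = M ^+ 2 * h ^+ 4 * (1 + D) ^+ 2
    by ring.
  have -> : 2 * M ^+ 2 * h ^+ 4 * (1 + D ^+ 2) =
    M ^+ 2 * h ^+ 4 * (2 * (1 + D ^+ 2)) by ring.
  have D2 : (1 + D) ^+ 2 <= 2 * (1 + D ^+ 2) by have := sqr_ge0 (1 - D); nra.
  by apply: ler_wpM2l => //; apply: mulr_ge0 => //; exact: sqr_ge0.
have absmu_ge0 al : 0 <= absmu0 KL al by exact: Rintegral_ge0.
have [bfin bbd] : Bint K KL a b X F n h \is a fin_num /\
    `|fine (Bint K KL a b X F n h) - \int[mu]_(x in mid) phi x| <=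
    h ^+ 4 * (e * (M + e)) * (b - a) + 2 * M ^+ 2 * h ^+ 4 * \int[mu]_x bw x.
  apply: (integral_interior_boundary h0 iphi ibw bw0 cc0 E0).
  - by move=> x; rewrite BE lee_fin; case: ifP => // _; exact: sqr_ge0.
  - by move=> x xab; rewrite BE (negbTE xab).
  - move=> x xm; rewrite BE ifT; last exact: mid_in.
    have xab := in_closed (mid_in xm).
    have := local_bias xm e0 hr uc; rewrite -/mu2.
    set q := h ^+ 2 / 2 * g2 x * mu2; set be := local_mean x - F x => hb.
    have hq : `|q| <= h ^+ 2 / 2 * M.
      have h20 : 0 <= h ^+ 2 / 2 by rewrite divr_ge0 ?sqr_ge0.
      case/andP: mu2_01 => ? ?.
      rewrite /q -mulrA normrM (ger0_norm h20) ler_wpM2l// normrM -[leRHS]mulr1.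
      by rewrite ler_pM ?g2M// ger0_norm.
    have hphi : phi x = q ^+ 2 by rewrite /phi /q; ring.
    rewrite hphi !lee_fin -ler_distl.
    have -> : be ^+ 2 - q ^+ 2 = (be - q) * ((be - q) + 2 * q) by ring.
    rewrite normrM.
    have h2 : `|(be - q) + 2 * q| <= e * h ^+ 2 / 2 + 2 * (h ^+ 2 / 2 * M).
      by apply: le_trans (ler_normD _ _) _;
        rewrite lerD// normrM ger0_norm// ler_wpM2l.
    apply: le_trans (ler_pM _ _ hb h2) _ => //.
    have -> : e * h ^+ 2 / 2 * (e * h ^+ 2 / 2 + 2 * (h ^+ 2 / 2 * M)) =
      h ^+ 4 * (e * (M / 2 + e / 4)) by field.
    by rewrite ler_wpM2l// ler_wpM2l//; have := M0; lra.
  - move=> x xx; rewrite BE ifT; last exact: left_in.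
    rewrite lee_fin; apply: le_trans (bias_sqr _ _ (absmu_ge0 _)
      (left_bias xx)) _.
    by rewrite ler_wpM2l// bwl.
  - move=> x xx; rewrite BE ifT; last exact: right_in.
    rewrite lee_fin; apply: le_trans (bias_sqr _ _ (absmu_ge0 _)
      (right_bias xx)) _.
    by rewrite ler_wpM2l// bwr.
rewrite Ibw in bbd; split=> //.
have I2 : `|\int[mu]_(x in `]a,
  b[) (g2 x ^+ 2) - \int[mu]_(x in mid) (g2 x ^+ 2)| <= M ^+ 2 * (2 * h * W).
  rewrite [X in X - _]Rintegral_mkcond.
  have := @integral_interior_boundary R a b h (M ^+ 2) 0 (fun x => (((fun x =>
    g2 x ^+ 2) \_ `]a, b[) x)%:E)
    (fun x => g2 x ^+ 2) bw h0 ig22 ibw bw0 (sqr_ge0 _) (lexx _).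
  rewrite mul0r add0r Ibw => H.
  have g2M2 x : a < x < b -> g2 x ^+ 2 <= M ^+ 2.
    case/andP=> ax xb; rewrite -real_normK ?num_real// lerXn2r
      ?nnegrE ?(ltW M0)//.
    by apply: g2M; rewrite in_itv/= !ltW.
  apply: (H _ _ _ _ _).2.
  - by move=> x; rewrite lee_fin patchE; case: ifP => // _; exact: sqr_ge0.
  - by move=> x xab; rewrite patchE mem_setE in_itv/= (negbTE xab).
  - move=> x xm; rewrite patchE mem_setE in_itv/= ifT ?mid_in//.
    by rewrite subr0 addr0 lexx.
  - move=> x xx; have xab := left_in xx.
    rewrite patchE mem_setE in_itv/= xab lee_fin;
      apply: le_trans (g2M2 _ xab) _.
    rewrite ler_peMr ?sqr_ge0//; apply: le_trans (bwl xx);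
      by rewrite lerDl sqr_ge0.
  - move=> x xx; have xab := right_in xx.
    rewrite patchE mem_setE in_itv/= xab lee_fin;
      apply: le_trans (g2M2 _ xab) _.
    rewrite ler_peMr ?sqr_ge0//; apply: le_trans (bwr xx);
      by rewrite lerDl sqr_ge0.
rewrite /Blead (intF2sqE dF dg1 cg2 (cdf_left (hdens 0%N) hsupp (hF 0%N))
  (cdf_right (hdens 0%N) hsupp (hF 0%N))) -/mu2.
move: bbd I2; rewrite /phi RintegralZl//.
set B := fine _; set C := \int[mu]_(x in mid) _;
  set C' := \int[mu]_(x in _) _ => bbd I2.
have -> : B - h ^+ 4 / 4 * mu2 ^+ 2 * C' =
    (B - (h ^+ 2 / 2 * mu2) ^+ 2 * C) - (h ^+ 2 / 2 * mu2) ^+ 2 * (C'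
      - C) by field.
apply: le_trans (ler_normB _ _) _.
have t2 : `|(h ^+ 2 / 2 * mu2) ^+ 2 * (C' - C)| <=
  h ^+ 4 * (M ^+ 2 * (2 * h * W)).
  rewrite normrM ler_pM// ger0_norm ?sqr_ge0//.
  have -> : (h ^+ 2 / 2 * mu2) ^+ 2 = h ^+ 4 * (mu2 ^+ 2 / 4) by field.
  rewrite -[leRHS]mulr1 ler_wpM2l//.
  have : mu2 ^+ 2 <= 1 by case/andP: mu2_01 => ? ?; rewrite exprn_ile1.
  lra.
apply: le_trans (lerD bbd t2) _.
have : 0 <= h ^+ 4 * (M ^+ 2 * (2 * h * W)).
  by rewrite !mulr_ge0 ?sqr_ge0 ?boundary_total_ge0// ltW.
lra.
Qed.

End pointwise.

(** * The mean integrated squared error *)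

Section mean_squared_error.
Context (R : realType) (d : measure_display) (T : measurableType d).
Variable P : probability T R.

Lemma mean_squared_error (Z : T -> R) (C c : R) :
  measurable_fun [set: T] Z -> (forall w, `|Z w| <= C) ->
  (\int[P]_w ((Z w - c) ^+ 2)%:E = variance P Z + ('E_P[Z] - c%:E) ^+ 2)%E.
Proof.
move=> mZ ZC.
have iZ := bounded_integrable P mZ ZC.
pose m := \int[P]_w Z w.
have EZ : ('E_P[Z] = m%:E)%E
  by rewrite unlock fineK//; exact: integrable_fin_num iZ.
have icst (k : R) : P.-integrable [set: T] (EFin \o cst k).
  by apply: (bounded_integrable _ (C := `|k|)).
have iB k : P.-integrable [set: T] (EFin \o (fun w => Z w - k)) :=
  integrableB measurableT iZ (icst k).
have isq k : P.-integrable [set: T] (EFin \o (fun w => (Z w - k) ^+ 2)).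
  apply: (bounded_integrable _ (C := (C + `|k|) ^+ 2)).
    by apply: measurable_funX; exact: measurable_funB.
  move=> w; rewrite normrX lerXn2r ?nnegrE ?addr_ge0 ?(le_trans _ (ZC w))//.
  by apply: le_trans (ler_normB _ _) _; rewrite lerD2r.
have varE : variance P Z = (\int[P]_w ((Z w - m) ^+ 2))%:E.
  rewrite /variance unlock EZ/= unlock fineK;
    last exact: integrable_fin_num (isq m).
  by apply: eq_integral => w _; rewrite !fctE expr2.
rewrite varE EZ -EFinB -EFin_expe -EFinD -[LHS]fineK;
  last exact: integrable_fin_num (isq c).
congr EFin; rewrite -/(Rintegral _ _ _).
have i2 : P.-integrable [set: T] (EFin \o (fun w => 2 * (m - c) * (Z w - m)))
  := integrableZl measurableT (2 * (m - c)) (iB m).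
transitivity (\int[P]_w ((Z w - m) ^+ 2 + 2 * (m - c) * (Z w - m) +
  (m - c) ^+ 2)).
  by apply: eq_Rintegral => w _; ring.
have iS : P.-integrable [set: T] (EFin \o (fun w => (Z w - m) ^+ 2 + 2 * (m -
  c) * (Z w - m))) :=
  integrableD measurableT (isq m) i2.
rewrite RintegralD//; last exact: icst ((m - c) ^+ 2).
rewrite RintegralD// RintegralZl// RintegralB//; last exact: icst m.
rewrite !Rintegral_prob_cst -/m.
by rewrite subrr mulr0 addr0.
Qed.

End mean_squared_error.

(** * Joint measurability of the estimator *)

Section joint_measurability.
Context (R : realType) (d : measure_display) (T : measurableType d).
Variables (K : R -> R) (KL : R -> R -> R) (a b h : R).
Hypothesis hab : a < b.
Hypothesis h0 : 0 < h <= (b - a) / 2.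
Hypothesis mK : measurable_fun [set: R] K.
Hypothesis jKL : jointly_measurable KL.
Local Notation mu := (@lebesgue_measure R).

(* KL is only known to be measurable for alpha in ]0, 1[, the only values at which
   the estimator uses it. *)
Let KL0 (u al : R) : R := if 0 < al < 1 then KL u al else 0.

Lemma estimator_truncated (S : Type) (X : nat -> S -> R) n x w :
  estimator K KL a b X n h x w = estimator K KL0 a b X n h x w.
Proof.
case/andP: h0 => hp hab2.
rewrite /estimator; have [xa//|ax] := leP x a; have [bx//|xb] := leP b x.
congr (_ * _); apply: eq_bigr => i _; rewrite /Kbar_loc.
have [xh|xh] := ltP x (a + h).
  rewrite /KbarL /KL0; apply: eq_Rintegral => v _.
  by rewrite divr_gt0 ?subr_gt0// ltr_pdivrMr// mul1r ltrBlDl xh.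
have [//|xh'] := leP x (b - h).
rewrite /KbarR /KR /KL0; congr (1 - _); apply: eq_Rintegral => v _.
rewrite divr_gt0 ?subr_gt0// ltr_pdivrMr// mul1r.
by rewrite (_ : b - x < h)//; lra.
Qed.

Let mKL0 : measurable_fun [set: measurableTypeR R * measurableTypeR R] (fun p
  => KL0 p.1 p.2).
Proof.
pose D : set (measurableTypeR R * measurableTypeR R) :=
  [set: R] `*` [set` `]0, 1[].
have mD : measurable D by apply: measurableX => //; exact: measurable_itv.
have -> : (fun p => KL0 p.1 p.2) =
  (fun p : measurableTypeR R * measurableTypeR R => KL p.1 p.2) \_ D.
  apply/funext => p; rewrite patchE /KL0; congr (if _ then _ else _).
  by apply/idP/idP; rewrite inE /D/= in_itv/=; [move=> ->|move=> []].
exact: (measurable_restrictT _ mD).1 jKL.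
Qed.

(** Tonelli's theorem for the MISE needs measurability in (x, w) together. Each boundary primitive
    is an integral over v whose integrand is jointly measurable in v and the parameters, once [KL]
    is truncated to alpha in ]0, 1[. *)
Lemma measurable_estimator (X : nat -> T -> R) n :
  (forall i, measurable_fun [set: T] (X i)) ->
  measurable_fun [set: measurableTypeR R * T] (fun z => estimator K KL a b
    X n h z.1 z.2).
Proof.
move=> mX; under eq_fun do rewrite estimator_truncated; rewrite /estimator.
have m1 : measurable_fun [set: measurableTypeR R * T] (fun z => z.1 : R)
  by exact: measurable_fst.
have mKbarL (u al : measurableTypeR R * T -> R) : measurable_fun setT u ->
  measurable_fun setT al ->
    measurable_fun setT (fun z => KbarL KL0 (u z) (al z)).
  move=> mu_ mal; rewrite (_ : (fun z => _) = fun z => \int[mu]_v (if v <=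
    u z then KL0 v (al z) else 0)).
    apply: (measurable_Rintegral_param mu
      (f := fun y : (measurableTypeR R * T) * measurableTypeR R => if y.2 <=
        u y.1 then KL0 y.2 (al y.1) else 0)).
    apply: measurable_if_le => //; last exact: measurableT_comp.
    have := measurableT_comp mKL0 (measurable_fun_pair measurable_snd
      (measurableT_comp mal measurable_fst)).
    exact.
  by apply/funext => z; exact: (KbarE (KL0^~ (al z)) (u z)).
have mKbarR (u al : measurableTypeR R * T -> R) : measurable_fun setT u ->
  measurable_fun setT al ->
    measurable_fun setT (fun z => KbarR KL0 (u z) (al z)).
  move=> mu_ mal; apply: measurable_funB => //.
  rewrite (_ : (fun z => _) = fun z => \int[mu]_v (if u z <=
    v then KL0 (- v) (al z) else 0)).
    apply: (measurable_Rintegral_param mu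
      (f := fun y : (measurableTypeR R * T) * measurableTypeR R => if u y.1 <=
        y.2 then KL0 (- y.2) (al y.1) else 0)).
    apply: measurable_if_le => //; last exact: measurableT_comp.
    have mN : measurable_fun [set: (measurableTypeR R * T) * measurableTypeR R]
      (fun y => - y.2 : measurableTypeR R).
      by apply: measurable_funN; exact: measurable_snd.
    have := measurableT_comp mKL0 (measurable_fun_pair mN (measurableT_comp mal
      measurable_fst)).
    exact.
  apply/funext => z; rewrite Rintegral_mkcond; apply: eq_Rintegral => v _.
  by rewrite patchE mem_setE in_itv/= andbT.
apply: measurable_fun_ifT => //; first exact: measurable_fun_ler.
apply: measurable_fun_ifT => //; first exact: measurable_fun_ler.
apply: measurable_funM => //; apply: measurable_sum => i.
have mXi : measurable_fun [set: measurableTypeR R * T] (fun z => (z.1 -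
  X i z.2) / h).
  by apply: measurable_funM => //; apply: measurable_funB => //;
    exact: measurableT_comp.
rewrite /Kbar_loc; apply: measurable_fun_ifT; first exact: measurable_fun_ltr.
  by apply: mKbarL => //; apply: measurable_funM => //; exact: measurable_funB.
apply: measurable_fun_ifT; first exact: measurable_fun_ler.
  by apply: measurableT_comp => //; exact: measurable_Kbar.
by apply: mKbarR => //; apply: measurable_funM => //; exact: measurable_funB.
Qed.

End joint_measurability.

(** * Decomposition into integrated variance and squared bias *)

Section MISE_decomposition.
Context (R : realType) (d : measure_display) (T : measurableType d).
Variables (P : probability T R) (X : nat -> {RV P >-> R}) (f F : R ->
  R) (a b : R)
  (K : R -> R) (KL : R -> R -> R) (h : R) (n : nat).
Hypothesis hab : a < b.
Hypothesis hdens : forall i, is_density (X i) f.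
Hypothesis hsupp : tsupport f = `[a, b]%classic.
Hypothesis hF : forall i x, cdf (X i) x = (F x)%:E.
Hypothesis hK : is_kernel K.
Hypothesis hKL : is_boundary_kernel KL.
Hypothesis jKL : jointly_measurable KL.
Hypothesis h0 : 0 < h <= (b - a) / 2.
Local Notation mu := (@lebesgue_measure R).

Let est x w := estimator K KL a b X n h x w.

Let est_bounded x : measurable_fun [set: T] (est x) /\ exists C, forall w,
  `|est x w| <= C.
Proof.
have [xab|xab] := boolP (a < x < b); last first.
  rewrite (_ : est x = cst (F x)).
    by split=> //; exists `|F x|.
  by apply/funext => w; exact: (estimator_out K KL hab hdens hsupp hF).
rewrite (_ : est x = fun w => n%:R^-1 * \sum_(i <
  n) local_kernel a b K KL h x (X i w)).
  split.
    apply: measurable_funM => //; apply: measurable_sum => i.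
    by apply: measurable_comp_RV; exact: (measurable_local_kernel
      hK hKL h0 xab).
  exists (`|n%:R^-1| * \sum_(i < n) local_bound a b K KL h x) => w.
  rewrite normrM ler_wpM2l//; apply: le_trans (ler_norm_sum _ _ _) _.
  by apply: ler_sum => i _; exact: (local_kernel_bounded hK hKL h0 _ xab).
by apply/funext => w; exact: (estimator_in X K KL h n w xab).
Qed.

Let mF : measurable_fun [set: R] F.
Proof.
by apply: (measurable_prob_le (P := P) (Y := X 0%N)) => //;
  exact: cdf_preimage (hF 0%N).
Qed.

(** Tonelli exchanges the expectation and the integral over x. Splitting the integral of the sum
    then requires the variance and the squared bias to be measurable in x, which again follows from
    joint measurability. *)
Lemma MISE_decomposition :
  MISE K KL a b X F n h = (Vint K KL a b X n h + Bint K KL a b X F n h)%E.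
Proof.
have mest : measurable_fun [set: measurableTypeR R * T] (fun z => est z.1 z.2).
  case: hK => mK _ _ _ _ _.
  exact: (measurable_estimator h0 mK jKL n (fun i => measurable_funPT (X i))).
pose sq (z : measurableTypeR R * T) := (est z.1 z.2 - F z.1) ^+ 2.
have msq : measurable_fun [set: measurableTypeR R * T] sq.
  apply: measurable_funX; apply: measurable_funB => //; exact: measurableT_comp.
have mEsq : measurable_fun [set: measurableTypeR R * T] (EFin \o sq)
  by exact/measurable_EFinP.
have sq0 z : (0 <= (EFin \o sq) z)%E by rewrite lee_fin sqr_ge0.
have ft := @fubini_tonelli _ _ _ _ R mu P (EFin \o sq) mEsq sq0.
rewrite /MISE (_ : (\int[P]_w _)%E =
  (\int[mu]_x fubini_F P (EFin \o sq) x)%E); last by rewrite ft.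
pose mm x := \int[P]_w est x w; pose qq x := \int[P]_w sq (x, w).
have mmm : measurable_fun [set: measurableTypeR R] mm :=
  measurable_Rintegral_param P mest.
have mqq : measurable_fun [set: measurableTypeR R] qq :=
  measurable_Rintegral_param P msq.
have EE x : ('E_P[est x] = (mm x)%:E)%E.
  have [mZ [C ZC]] := est_bounded x; rewrite unlock /mm /Rintegral fineK//.
  exact: integrable_fin_num (bounded_integrable P mZ ZC).
have mse x : (\int[P]_w (sq (x, w))%:E =
  variance P (est x) + ('E_P[est x] - (F x)%:E) ^+ 2)%E.
  by have [mZ [C ZC]] := est_bounded x;
    exact: (mean_squared_error P (F x) mZ ZC).
(* Expresses the variance through parameter integrals, from which its measurability in x can be read
   off. *)
have VE x : variance P (est x) = (qq x - (mm x - F x) ^+ 2)%:E.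
  have [mZ [C ZC]] := est_bounded x.
  have C0 : 0 <= C by exact: le_trans (ZC point).
  have qfin : (\int[P]_w (sq (x, w))%:E)%E \is a fin_num.
    apply: integrable_fin_num => //.
    apply: (bounded_integrable P (C := (C + `|F x|) ^+ 2)).
      by apply: measurable_funX; apply: (measurable_funB (f := est x) (g :=
        cst (F x))).
    move=> w; rewrite normrX lerXn2r ?nnegrE ?addr_ge0//.
    by apply: le_trans (ler_normB _ _) _; rewrite lerD2r.
  rewrite EFinB /qq /Rintegral fineK// mse EE -EFinB -EFin_expe.
  by rewrite addeK.
rewrite /Vint /Bint -ge0_integralD//.
- by apply: eq_integral => x _; exact: mse.
- by move=> x _; exact: variance_ge0.
- rewrite (_ : (fun x => _) = fun x => (qq x - (mm x - F x) ^+ 2)%:E); last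
  by apply/funext => x; exact: VE.
  by apply/measurable_EFinP; apply: measurable_funB => //;
    apply: measurable_funX; exact: measurable_funB.
- by move=> x _; rewrite EE -EFinB -EFin_expe lee_fin sqr_ge0.
- rewrite (_ : (fun x => _) = fun x => ((mm x - F x) ^+ 2)%:E); last first.
    by apply/funext => x; rewrite EE -EFinB -EFin_expe.
  by apply/measurable_EFinP; apply: measurable_funX; exact: measurable_funB.
Qed.

End MISE_decomposition.

(** * The optimal bandwidth *)

Section uniform.
Context (R : realType).
Local Notation mu := (@lebesgue_measure R).
Variables (a b : R) (hab : a < b) (F g1 g2 : R -> R).
Hypothesis dF : forall t, t \in `[a, b] -> is_derive_in `[a, b] F t (g1 t).
Hypothesis dg1 : forall t, t \in `[a, b] -> is_derive_in `[a, b] g1 t (g2 t).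
Hypothesis cg2 : {within `[a, b], continuous g2}.
Hypothesis Fa : forall t, t <= a -> F t = 0.
Hypothesis Fb : forall t, b <= t -> F t = 1.

Let ba0 : b - a != 0. Proof. by rewrite subr_eq0 gt_eqF. Qed.

Lemma uniform_cdf (t : R) : fine (uniform_prob hab `]-oo, t]) =
  if t <= a then 0 else if b <= t then 1 else (t - a) / (b - a).
Proof.
rewrite /uniform_prob.
have [ta|at_] := leP t a.
  (* The uniform density does not vanish at a, which belongs to the half-line when t = a; the closed
     end point is then removed as a null set. *)
  rewrite (eq_integral (fun x :
    measurableTypeR R => if x == a then (uniform_pdf a b x)%:E else 0%E));
    last first.
    move=> x; rewrite inE/= in_itv/= => xt; have [//|xa] := eqVneq x a.
    rewrite /uniform_pdf ifF//; apply/negbTE; rewrite negb_and -ltNge;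
      apply/orP; left.
    by rewrite lt_neqAle xa (le_trans xt ta).
  rewrite -integral_itv_bndo_bndc; last first.
    apply: measurable_funTS; apply: measurable_fun_ifT => //;
      first exact: measurable_fun_eqr.
    by apply/measurable_EFinP; exact: measurable_uniform_pdf.
  rewrite (eq_integral (cst 0%E)) ?integral0// => x;
    rewrite inE/= in_itv/= => xt.
  by rewrite (lt_eqF (lt_le_trans xt ta)).
have [bt|tb] := leP b t.
  by rewrite integral_uniform_pdf1// => x /=;
    rewrite !in_itv/= => /andP[_ /le_trans]; apply.
rewrite integral_uniform_pdf (_ : _ `&` _ = `[a, t]%classic); last first.
  apply/seteqP; split => x /=; rewrite !in_itv/=;
    first by move=> [-> /andP[-> _]].
  by move=> /andP[-> xt]; rewrite xt (le_trans xt (ltW tb)).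
rewrite (eq_integral (fun=> (b - a)^-1%:E)); last first.
  by move=> x; rewrite inE/= in_itv/= /uniform_pdf => /andP[-> xt];
    rewrite (le_trans xt (ltW tb)).
by rewrite integral_cst//= lebesgue_measure_itv/= lte_fin at_ -EFinD
  -EFinM/= mulrC.
Qed.

Let ig22 : mu.-integrable `]a, b[ (EFin \o (fun x => g2 x ^+ 2)).
Proof.
apply: (@integrableS _ _ _ mu `[a, b]%classic) => //;
  first exact: subset_itv_oo_cc.
apply: continuous_compact_integrable; first exact: segment_compact.
rewrite (_ : (fun x => g2 x ^+ 2) = (fun x => g2 x * g2 x)); last
  by apply/funext => x; rewrite expr2.
by move=> x; apply: cvgM; exact: cg2.
Qed.

Let integral_sqr_gt0 (x0 : R) : x0 \in `[a, b] -> g2 x0 != 0 ->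
  0 < \int[mu]_(x in `]a, b[) (g2 x ^+ 2).
Proof.
move=> x0ab g20; pose e := `|g2 x0| / 2.
have e0 : 0 < e by rewrite divr_gt0 ?normr_gt0.
have [r r0 uc] := heine (segment_compact (a := a) (b := b)) cg2 e0.
(* A quarter leaves room for an interval ]p, p + s[ within distance r of [x0] and inside [a, b], to
   the right or to the left of [x0] according to the half that contains it; [x0] may be an end
   point. *)
pose s := Num.min r (b - a) / 4.
have s0 : 0 < s by rewrite divr_gt0// lt_min r0 subr_gt0.
have sr : 4 * s <= r by rewrite /s mulrC divfK// ge_min lexx.
have sb : 4 * s <= b - a by rewrite /s mulrC divfK// ge_min lexx orbT.
have [p [ap pb pr]] : exists p, [/\ a <= p, p + s <= b &
    forall x, x \in `]p, p + s[ -> `|x - x0| < r].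
  move: (x0ab); rewrite in_itv/= => /andP[ax xb].
  have [xm|xm] := leP x0 ((a + b) / 2).
    exists (x0 + s); split; [lra|lra|move=> x;
      rewrite in_itv/= => /andP[h1 h2]].
    by rewrite ltr_norml; apply/andP; split; lra.
  exists (x0 - 2 * s); split; [lra|lra|move=> x;
    rewrite in_itv/= => /andP[h1 h2]].
  by rewrite ltr_norml; apply/andP; split; lra.
have low : \int[mu]_(x in `]a, b[) ((cst (e ^+ 2)) \_ `]p, p + s[) x =
  e ^+ 2 * s.
  rewrite -Rintegral_mkcondr setIidr; last first.
    by move=> x /=; rewrite !in_itv/= => /andP[px xp];
      rewrite (le_lt_trans ap px) (lt_le_trans xp pb).
  by rewrite Rintegral_cst//= lebesgue_measure_itv/= lte_fin ltrDl s0 -EFinD/=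
    addrAC subrr add0r.
apply: (@lt_le_trans _ _ (e ^+ 2 * s)); first by rewrite mulr_gt0// exprn_gt0.
rewrite -low; apply: le_Rintegral => //.
  apply: measurable_bounded_integrable => //.
  - by rewrite /= lebesgue_measure_itv/= lte_fin hab -EFinD ltry.
  - by apply: measurable_funTS; apply/(measurable_restrictT _ _).1.
  - exists (e ^+ 2); split; [exact: num_real|move=> y ey x _ /=].
    by rewrite patchE; case: ifP => _;
      rewrite ?normr0 ?ger0_norm ?sqr_ge0 ?(le_trans (sqr_ge0 _)
      (ltW ey))// ltW.
move=> x xab; rewrite patchE mem_setE; case: ifPn => [xp|_];
  last exact: sqr_ge0.
have xab' : x \in `[a, b] by exact: subset_itv_oo_cc.
rewrite -[leRHS]real_normK ?num_real// lerXn2r ?nnegrE ?(ltW e0)//.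
have := uc _ _ x0ab xab' (pr _ xp).
have : `|g2 x0| <= `|g2 x| + `|g2 x - g2 x0|
  by rewrite -{1}(subKr (g2 x) (g2 x0)); exact: ler_normB.
by rewrite /e; lra.
Qed.

(** If the integral were 0, continuity would give [g2] = 0 on [a, b]; F would be affine there, and
    F(a) = 0 and F(b) = 1 would make it uniform. *)
Lemma intF2sq_gt0 : F <> (fun x => fine (uniform_prob hab `]-oo, x])) ->
  0 < intF2sq F.
Proof.
move=> nunif; rewrite (intF2sqE dF dg1 cg2 Fa Fb).
have [//|I0] := ltP 0 (\int[mu]_(x in `]a, b[) (g2 x ^+ 2)).
exfalso; apply: nunif.
have g20 z : z \in `[a, b] -> g2 z = 0.
  move=> zab; apply/eqP/negPn/negP => /(integral_sqr_gt0 zab).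
  by rewrite ltNge I0.
have aab : a \in `[a, b] by rewrite in_itv/= lexx ltW.
have lin y : y \in `[a, b] -> F y = (y - a) * g1 a.
  move=> yab; have [z [zab _ ->]] := taylor_lagrange dF dg1 aab yab.
  by rewrite Fa// g20// mulr0 addr0 add0r.
have g1a : g1 a = (b - a)^-1.
  have bab : b \in `[a, b] by rewrite in_itv/= lexx ltW.
  by have := lin b bab; rewrite Fb// => h; rewrite -[LHS](mulKf ba0) -h mulr1.
apply/funext => t; rewrite uniform_cdf.
have [/Fa//|at_] := leP t a; have [/Fb//|tb] := leP b t.
by rewrite lin ?g1a// in_itv/= !ltW.
Qed.

End uniform.

(** * Minimising the leading terms *)

Section optimal_bandwidth.
Context (R : realType).

Lemma powR_third_cube (x : R) : 0 <= x -> (x `^ (1 / 3)) ^+ 3 = x.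
Proof.
move=> x0; rewrite -powR_mulrn ?powR_ge0// -powRrM.
by rewrite (_ : 1 / 3 * 3%:R = 1) ?powRr1//; field.
Qed.

(** The cube puts the closed formula in the form of the critical equation m^2 I t^3 = kap / n of the
    leading terms. *)
Lemma h_opt_cube (kap m I n : R) : 0 < kap -> 0 < m -> 0 < I -> 0 < n ->
  (kap `^ (1 / 3) * m `^ (- (2 / 3)) * I `^ (- (1 / 3)) * n `^ (-
    (1 / 3))) ^+ 3 =
  kap / (m ^+ 2 * I * n).
Proof.
move=> k0 m0 I0 n0; rewrite !powRN.
have -> : m `^ (2 / 3) = (m `^ (1 / 3)) ^+ 2.
  by rewrite -powR_mulrn ?powR_ge0// -powRrM; congr (_ `^ _); field.
(* In terms of the four cube roots the claim is a rational identity. *)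
rewrite -[in RHS](powR_third_cube (ltW k0)) -[in RHS](powR_third_cube (ltW m0)).
rewrite -[in RHS](powR_third_cube (ltW I0)) -[in RHS](powR_third_cube (ltW n0)).
have := powR_gt0 (1 / 3) m0; have := powR_gt0 (1 / 3) I0.
have := powR_gt0 (1 / 3) n0.
move: (kap `^ _) (m `^ _) (I `^ _) (n `^ _) => x y z w w0 z0 y0.
by field; rewrite !lt0r_neq0.
Qed.

(* The difference of the values at t and t0 is a positive multiple of
   (t - t0)^2 (t^2 + 2 t t0 + 3 t0^2). *)
Lemma quartic_minimum (A c q t t0 : R) : 0 < q -> 0 < t0 -> q * t0 ^+ 3 = c ->
  0 < t -> t != t0 ->
  A - t0 * c + t0 ^+ 4 / 4 * q < A - t * c + t ^+ 4 / 4 * q.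
Proof.
move=> q0 t00 <- t_gt0 tt0; rewrite -subr_gt0.
have -> : A - t * (q * t0 ^+ 3) + t ^+ 4 / 4 * q - (A - t0 * (q * t0 ^+ 3) + t0
  ^+ 4 / 4 * q) =
  q / 4 * (t - t0) ^+ 2 * (t ^+ 2 + 2 * t * t0 + 3 * t0 ^+ 2) by field.
apply: mulr_gt0; first by rewrite mulr_gt0 ?divr_gt0// lt_neqAle sqr_ge0 eq_sym
  expf_eq0 subr_eq0 tt0.
by rewrite !addr_gt0// ?mulr_gt0// ?exprn_gt0.
Qed.

Lemma h_opt_minimises (K F : R -> R) (n : nat) : is_kernel K ->
  0 < intF2sq F -> (0 < n)%N ->
  0 < h_opt K F n /\
  forall t, 0 < t -> t != h_opt K F n ->
    Vlead K F n (h_opt K F n) + Blead K F (h_opt K F n) <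
      Vlead K F n t + Blead K F t.
Proof.
move=> hK I0 n0; have k0 := kernel_kappa_gt0 hK; have m0 := kernel_mu2_gt0 hK.
have nR : 0 < n%:R :> R by rewrite ltr0n.
rewrite /Vlead /Blead; set t0 := h_opt K F n.
have t00 : 0 < t0 by rewrite /t0 /h_opt /deltaK !mulr_gt0 ?powR_gt0.
have t03 := h_opt_cube k0 m0 I0 nR.
move: t03; rewrite -[X in X ^+ 3]/t0; set kap := \int[_]_u _ in k0 *;
  set mm := \int[_]_u _ in m0 *.
set A := \int[_]_x _; set I := intF2sq F in I0 * => t03; split=> // t t_gt0 tt0.
have := @quartic_minimum (n%:R^-1 * A) (kap / n%:R) (mm ^+ 2 * I) t t0 _
  t00 _ t_gt0 tt0.
have E x : n%:R^-1 * A - x / n%:R * kap + x ^+ 4 / 4 * mm ^+ 2 * I =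
  n%:R^-1 * A - x * (kap / n%:R) + x ^+ 4 / 4 * (mm ^+ 2 * I) by ring.
rewrite !E; apply; first by rewrite mulr_gt0// exprn_gt0.
rewrite t03; field.
by rewrite !lt0r_neq0.
Qed.

End optimal_bandwidth.

Theorem theorem2 (R : realType) (d : measure_display) (T : measurableType d)
    (P : probability T R) (X : nat -> {RV P >-> R}) (f F : R -> R) (a b : R)
    (K : R -> R) (KL : R -> R -> R) (h : nat -> R)
    (hab : a < b)
    (hindep : mutually_independent X)
    (hdens : forall i, is_density (X i) f)
    (hsupp : tsupport f = `[a, b]%classic)
    (hF : forall i x, cdf (X i) x = (F x)%:E)
    (hK : is_kernel K)
    (hKL : is_boundary_kernel KL)
    (hh : forall n, 0 < h n <= (b - a) / 2)
    (hh0 : h @ \oo --> (0 : R))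
    (hmu : forall al : R, 0 < al < 1 -> al * (1 - muL KL 0 al) + muL KL 1 al = 0)
    (hmu0 : (@lebesgue_measure R).-integrable `]0, 1[
      (fun al => (absmu0 KL al ^+ 2)%:E))
    (hC2 : C2_on `[a, b] F) :
  [/\ (forall n, (0 < n)%N ->
         Vint K KL a b X n (h n) \is a fin_num /\
         Bint K KL a b X F n (h n) \is a fin_num),
      (fun n => fine (Vint K KL a b X n (h n)) - Vlead K F n (h n))
        =O_\oo (fun n => n%:R^-1 * h n ^+ 2 : R),
      (fun n => fine (Bint K KL a b X F n (h n)) - Blead K F (h n))
        =o_\oo (fun n => h n ^+ 4 : R),
      (jointly_measurable KL ->
         forall n, (0 < n)%N ->
           MISE K KL a b X F n (h n) =
             (Vint K KL a b X n (h n) + Bint K KL a b X F n (h n))%E) &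
      (F <> (fun x => fine (uniform_prob hab `]-oo, x])) ->
         forall n, (0 < n)%N ->
           0 < h_opt K F n /\
           forall t, 0 < t -> t != h_opt K F n ->
             Vlead K F n (h_opt K F n) + Blead K F (h_opt K F n) <
             Vlead K F n t + Blead K F t)].
Proof.
have [g1 [g2 [dF dg1 cg2]]] := hC2.
have [M M0 g2M] := compact_continuous_bounded (segment_compact (a :=
  a) (b := b)) cg2.
have Fa := cdf_left (hdens 0%N) hsupp (hF 0%N).
have Fb := cdf_right (hdens 0%N) hsupp (hF 0%N).
have Vn n (n0 : (0 < n)%N) :=
  Vint_expansion hab hindep hdens hsupp hF hK hKL dF dg1 M0 g2M (hh n) hmu0 n0.
have Bn n e r (n0 : (0 < n)%N) :=
  Bint_expansion hab hdens hsupp hF hK hKL hmu dF dg1 M0 g2M (hh n) cg2 hmu0 n0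
  (e := e) (r := r).
set W := \int[lebesgue_measure]_(al in `]0, 1[) _ in Vn Bn.
have W0 : 0 <= W by apply: Rintegral_ge0 => al _; rewrite addr_ge0// sqr_ge0.
have hp n : 0 < h n by case/andP: (hh n).
have nearn : \forall n \near \oo, (0 < n)%N by exact: nbhs_infty_gt.
split.
- move=> n n0; split; first exact: (Vn n n0).1.
  (* Only finiteness is wanted: as |g2| <= M, e = 2 M is a modulus at every distance, and any r
     beyond h will do. *)
  apply: (Bn n (2 * M) (h n + 1) n0 _ _ _).1.
  + by rewrite mulr_ge0// ltW.
  + by rewrite ltrDl.
  + move=> y z yab zab _; apply: le_trans (ler_normB _ _) _.
    by rewrite mulr_natl mulr2n lerD ?g2M.
- apply/eqO_exP => /=.
  (* The constant of [Vint_expansion] involves neither n nor h; |C| + 1 makes it positive. *)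
  have [C VC] : exists C, forall n, (0 < n)%N ->
      `|fine (Vint K KL a b X n (h n)) - Vlead K F n (h n)| <=
        n%:R^-1 * h n ^+ 2 * C.
    by eexists => n n0; exact: (Vn n n0).2.
  exists (`|C| + 1); first by rewrite ltr_wpDl.
  near=> n; have n0 : (0 < n)%N by near: n.
  apply: le_trans (VC n n0) _.
  have nh : 0 <= n%:R^-1 * h n ^+ 2 by rewrite mulr_ge0 ?sqr_ge0// invr_ge0.
  rewrite [`|_ * h n ^+ 2|]ger0_norm// mulrC ler_wpM2r//.
  by apply: le_trans (ler_norm _) _; rewrite lerDl.
- apply/eqoP => /= eps eps0.
  set B0 := b - a in Bn; have B00 : 0 < B0 by rewrite subr_gt0.
  (* Since e <= 1, the interior error e (M + e) (b - a) is at most e (M + 1) (b - a), hence at most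
     eps / 2; the other half of eps is reached by D h for h small. *)
  pose e := Num.min 1 (eps / (2 * B0 * (M + 1))).
  have d0 : 0 < 2 * B0 * (M + 1) by rewrite !mulr_gt0// addr_gt0.
  have e0 : 0 < e by rewrite lt_min ltr01 divr_gt0.
  have e1 : e <= 1 by rewrite ge_min lexx.
  have eB : e * (2 * B0 * (M + 1)) <= eps
    by rewrite -ler_pdivlMr// ge_min lexx orbT.
  have [r r0 uc] := heine (segment_compact (a := a) (b := b)) cg2 e0.
  pose D := 10 * M ^+ 2 * W.
  have D0 : 0 <= D by rewrite mulr_ge0// mulr_ge0 ?sqr_ge0.
  near=> n; have n0 : (0 < n)%N by near: n.
  have hr : h n < r.
    by near: n; move/cvgrPdist_lt : hh0 => /(_ _ r0); apply: filterS => n;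
      rewrite sub0r normrN gtr0_norm.
  have hD : h n < eps / (2 * (D + 1)).
    near: n; have r1 : 0 <
      eps / (2 * (D + 1)) by rewrite divr_gt0// mulr_gt0// ltr_wpDl.
    by move/cvgrPdist_lt : hh0 => /(_ _ r1); apply: filterS => n;
      rewrite sub0r normrN gtr0_norm.
  apply: le_trans (Bn n e r n0 (ltW e0) hr uc).2 _; rewrite -/D.
  have h4 : 0 <= h n ^+ 4 by rewrite exprn_ge0// ltW.
  rewrite [`|h n ^+ 4|]ger0_norm// mulrC ler_wpM2r//.
  have t1 : e * (M + e) * B0 <= eps / 2.
    have : e * (M + e) <= e * (M + 1) by rewrite ler_wpM2l ?(ltW e0)// lerD2l.
    move/(ler_wpM2r (ltW B00)) => /le_trans; apply.
    by rewrite ler_pdivlMr//; apply: le_trans eB; rewrite le_eqVlt; apply/orP;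
      left; apply/eqP; ring.
  have t2 : D * h n <= eps / 2.
    have D1 : 0 < 2 * (D + 1) by rewrite mulr_gt0// ltr_wpDl.
    move: hD; rewrite ltr_pdivlMr// => hD.
    rewrite ler_pdivlMr//; apply: ltW; apply: le_lt_trans hD.
    by have := hp n; lra.
  by lra.
- by move=> jKL n _; exact: (MISE_decomposition n hab hdens hsupp hF hK
  hKL jKL (hh n)).
- move=> nunif n n0; apply: h_opt_minimises => //.
  exact: (intF2sq_gt0 dF dg1 cg2 Fa Fb nunif).
Unshelve. all: by end_near. Qed.
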